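(* Let $(n_k)_{k\geq 0}$ be a strictly increasing sequence of positive integers. Then $(n_k)_{k\ge 0}$ is a Hilbertian Jamison sequence if and only if it is a Jamison sequence.
   Context: For a bounded operator $T$ on a Banach space, $\sigma_p(T)$ denotes its point spectrum (set of eigenvalues) and $\mathbb{T}=\{\lambda\in\mathbb{C}:|\lambda|=1\}$. $T$ is partially power-bounded with respect to $(n_k)$ if $\sup_{k\ge0}\|T^{n_k}\|<+\infty$. A sequence $(n_k)$ is a Jamison sequence if for every separable complex Banach space $X$ and every bounded operator $T$ on $X$ that is partially power-bounded with respect to $(n_k)$, the set $\sigma_p(T)\cap\mathbb{T}$ is at most countable. It is a Hilbertian Jamison sequence if the same conclusion holds for every bounded operator $T$ on a separable infinite-dimensional complex Hilbert space that is partially power-bounded with respect to $(n_k)$. *)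

(* Defs.v *)
From Stdlib Require Import Reals.
Open Scope R_scope.

Definition C : Type := (R * R)%type.
Definition C0 : C := (0, 0).
Definition C1 : C := (1, 0).
Definition Cadd (a b : C) : C := (fst a + fst b, snd a + snd b).
Definition Copp (a : C) : C := (- fst a, - snd a).
Definition Cmul (a b : C) : C :=
  (fst a * fst b - snd a * snd b, fst a * snd b + snd a * fst b).
Definition Cconj (a : C) : C := (fst a, - snd a).
Definition Cmod (a : C) : R := sqrt (fst a ^ 2 + snd a ^ 2).

Record CNormedSpace : Type := {
  carrier :> Type;
  vzero : carrier;
  vadd : carrier -> carrier -> carrier;
  vopp : carrier -> carrier;
  vscal : C -> carrier -> carrier;
  vnorm : carrier -> R;
  vadd_assoc : forall x y z, vadd x (vadd y z) = vadd (vadd x y) z;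
  vadd_comm : forall x y, vadd x y = vadd y x;
  vadd_zero : forall x, vadd x vzero = x;
  vadd_opp : forall x, vadd x (vopp x) = vzero;
  vscal_assoc : forall a b x, vscal a (vscal b x) = vscal (Cmul a b) x;
  vscal_one : forall x, vscal C1 x = x;
  vscal_distr_v : forall a x y, vscal a (vadd x y) = vadd (vscal a x) (vscal a y);
  vscal_distr_c : forall a b x, vscal (Cadd a b) x = vadd (vscal a x) (vscal b x);
  vnorm_nonneg : forall x, 0 <= vnorm x;
  vnorm_eq0 : forall x, vnorm x = 0 -> x = vzero;
  vnorm_scal : forall a x, vnorm (vscal a x) = Cmod a * vnorm x;
  vnorm_triangle : forall x y, vnorm (vadd x y) <= vnorm x + vnorm y
}.

Arguments vzero {c}.
Arguments vadd {c}.
Arguments vopp {c}.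
Arguments vscal {c}.
Arguments vnorm {c}.

Definition vsub {X : CNormedSpace} (x y : X) : X := vadd x (vopp y).

Definition cauchy_seq {X : CNormedSpace} (u : nat -> X) : Prop :=
  forall eps, 0 < eps -> exists N, forall p q, (N <= p)%nat -> (N <= q)%nat ->
    vnorm (vsub (u p) (u q)) < eps.

Definition converges_to {X : CNormedSpace} (u : nat -> X) (l : X) : Prop :=
  forall eps, 0 < eps -> exists N, forall p, (N <= p)%nat -> vnorm (vsub (u p) l) < eps.

Definition complete (X : CNormedSpace) : Prop :=
  forall u : nat -> X, cauchy_seq u -> exists l, converges_to u l.

Definition separable (X : CNormedSpace) : Prop :=
  exists d : nat -> X, forall (x : X) eps, 0 < eps -> exists k, vnorm (vsub x (d k)) < eps.

Record SepBanach : Type := {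
  sb_space :> CNormedSpace;
  sb_complete : complete sb_space;
  sb_separable : separable sb_space
}.

Fixpoint lincomb {X : CNormedSpace} (c : nat -> C) (v : nat -> X) (m : nat) : X :=
  match m with
  | O => vzero
  | S m' => vadd (lincomb c v m') (vscal (c m') (v m'))
  end.

Definition lin_indep {X : CNormedSpace} (v : nat -> X) (m : nat) : Prop :=
  forall c : nat -> C, lincomb c v m = vzero -> forall i, (i < m)%nat -> c i = C0.

Definition infinite_dimensional (X : CNormedSpace) : Prop :=
  forall m : nat, exists v : nat -> X, lin_indep v m.

Record SepHilbert : Type := {
  sh_space :> SepBanach;
  inner : sh_space -> sh_space -> C;
  inner_add_l : forall x y z, inner (vadd x y) z = Cadd (inner x z) (inner y z);
  inner_scal_l : forall a x y, inner (vscal a x) y = Cmul a (inner x y);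
  inner_conj_sym : forall x y, inner y x = Cconj (inner x y);
  inner_norm : forall x, inner x x = (vnorm x ^ 2, 0)
}.

Definition bounded_operator {X : CNormedSpace} (T : X -> X) : Prop :=
  (forall x y, T (vadd x y) = vadd (T x) (T y)) /\
  (forall a x, T (vscal a x) = vscal a (T x)) /\
  (exists M, forall x, vnorm (T x) <= M * vnorm x).

(* sup_k ||T^{n_k}|| < +oo, with the operator norm unfolded *)
Definition partially_power_bounded {X : CNormedSpace} (T : X -> X) (n : nat -> nat) : Prop :=
  exists M, forall k x, vnorm (Nat.iter (n k) T x) <= M * vnorm x.

Definition eigenvalue {X : CNormedSpace} (T : X -> X) (lam : C) : Prop :=
  exists x : X, x <> vzero /\ T x = vscal lam x.

Definition unimodular_point_spectrum_countable {X : CNormedSpace} (T : X -> X) : Prop :=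
  exists f : nat -> C, forall lam, Cmod lam = 1 -> eigenvalue T lam -> exists k, f k = lam.

Definition Jamison_sequence (n : nat -> nat) : Prop :=
  forall (X : SepBanach) (T : X -> X), bounded_operator T ->
    partially_power_bounded T n -> unimodular_point_spectrum_countable T.

Definition Hilbertian_Jamison_sequence (n : nat -> nat) : Prop :=
  forall (H : SepHilbert), infinite_dimensional H -> forall (T : H -> H),
    bounded_operator T -> partially_power_bounded T n ->
    unimodular_point_spectrum_countable T.

(* Main.v *)
From Stdlib Require Import Reals Lra Lia List Arith Cantor.
From Stdlib Require Import Classical ClassicalEpsilon FunctionalExtensionality ProofIrrelevance.
From Coquelicot Require Import Coquelicot.
Require Import Defs.

(* If n is not a Jamison sequence, then by separability there are unimodular mu <> 1 with
   |mu^N - 1| arbitrarily small uniformly in N = 1, n 0, n 1, ...  Choose such mu_j with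
   |mu_j^N - 1| <= 4^-j and |mu_(j+1) - 1| <= |mu_j - 1| / 5.  On C^2 the operator
   t_j(c) e_0 = e_0, t_j(c) e_1 = c e_1 + 2^j (c - 1) e_0 is multiplicative in c, has the
   eigenvectors e_0 and e_0 + 2^-j e_1 for the eigenvalues 1 and c, and differs from the
   identity by at most 2 * 2^-j when |c - 1| <= 4^-j.  Hence the infinite tensor product T of
   the t_j(mu_j) exists on the Hilbert space of the infinite tensor power of (C^2, e_0), the
   powers T^N (the tensor products of the t_j(mu_j^N)) are bounded by exp 4, and every
   s in {0,1}^nat gives an eigenvector, the tensor product of the e_0 + s_j 2^-j e_1, for the
   eigenvalue prod_j mu_j^(s_j).  These eigenvalues are pairwise distinct.
   The tensor power is realised as l2(nat), the factor j being the j-th binary digit of the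
   index. *)

(** * Nonnegative series and reindexing by partial injections *)

Lemma sum_n_le_Series (f : nat -> R) (N : nat) :
  (forall i, 0 <= f i) -> ex_series f -> sum_n f N <= Series f.
Proof.
  intros Hf Hs.
  apply (is_lim_seq_incr_compare (sum_n f)).
  - apply Series_correct, Hs.
  - intros m. rewrite sum_Sn. unfold plus; simpl. specialize (Hf (S m)). lra.
Qed.

Lemma ex_series_bounded (f : nat -> R) (B : R) :
  (forall i, 0 <= f i) -> (forall N, sum_n f N <= B) -> ex_series f /\ Series f <= B.
Proof.
  intros Hf HB.
  destruct (ex_finite_lim_seq_incr (sum_n f) B) as [l Hl].
  - intros m. rewrite sum_Sn. unfold plus; simpl. specialize (Hf (S m)). lra.
  - exact HB.
  - assert (Hs : is_series f l) by exact Hl.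
    split; [now exists l|].
    rewrite (is_series_unique _ _ Hs).
    apply (is_lim_seq_le (sum_n f) (fun _ => B) l B HB Hl (is_lim_seq_const B)).
Qed.

Lemma Series_ge0 (f : nat -> R) : (forall i, 0 <= f i) -> ex_series f -> 0 <= Series f.
Proof.
  intros Hf Hs. apply Rle_trans with (sum_n f 0).
  - rewrite sum_O. apply Hf.
  - now apply sum_n_le_Series.
Qed.

(** Lists serve as finite index sets that need not be initial segments; such sets arise when a
    partial sum is reindexed. *)
Definition lsum (f : nat -> R) (l : list nat) : R := fold_right (fun i s => f i + s) 0 l.

Lemma lsum_app (f : nat -> R) (l l' : list nat) : lsum f (l ++ l') = lsum f l + lsum f l'.
Proof. induction l as [|i l IH]; simpl; [|rewrite IH]; lra. Qed.

Lemma lsum_seq (f : nat -> R) (N : nat) : lsum f (seq 0 (S N)) = sum_n f N.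
Proof.
  induction N as [|N IH].
  - rewrite sum_O. simpl. lra.
  - rewrite seq_S, lsum_app, IH, sum_Sn. unfold plus; simpl. lra.
Qed.

Lemma lsum_incl (f : nat -> R) (l l' : list nat) :
  (forall i, 0 <= f i) -> NoDup l -> incl l l' -> lsum f l <= lsum f l'.
Proof.
  intros Hf. revert l'. induction l as [|i l IH]; intros l' Hd Hi; simpl.
  - clear Hi. induction l' as [|i l' IH']; simpl; [lra|]. specialize (Hf i). lra.
  - inversion Hd as [|? ? Hn Hd']; subst.
    destruct (in_split i l' (Hi i (or_introl eq_refl))) as (l1 & l2 & ->).
    rewrite lsum_app. simpl.
    assert (lsum f l <= lsum f (l1 ++ l2)) as H.
    { apply IH; [exact Hd'|]. intros k Hk.
      assert (Hk' := Hi k (or_intror Hk)). apply in_app_iff in Hk'. simpl in Hk'.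
      apply in_app_iff. destruct Hk' as [Hk'|[Hk'|Hk']]; auto. subst; contradiction. }
    rewrite lsum_app in H. lra.
Qed.

Lemma lsum_le_Series (f : nat -> R) (l : list nat) :
  (forall i, 0 <= f i) -> ex_series f -> NoDup l -> lsum f l <= Series f.
Proof.
  intros Hf Hs Hd.
  (* A duplicate-free list is dominated by the initial segment reaching up to its maximum. *)
  apply Rle_trans with (lsum f (seq 0 (S (list_max l)))).
  - apply lsum_incl; trivial. intros i Hi. apply in_seq.
    assert (H : List.Forall (fun k => (k <= list_max l)%nat) l) by now apply list_max_le.
    rewrite List.Forall_forall in H. specialize (H i Hi). lia.
  - rewrite lsum_seq. now apply sum_n_le_Series.
Qed.

Definition pinj (p : nat -> option nat) : Prop :=
  forall a a' b, p a = Some b -> p a' = Some b -> a = a'.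

(** Composition of [x] with a partial map, extended by the default [z]. It is polymorphic because it
    is applied both to complex sequences and to the real sequences of their squared moduli. *)
Definition pull {A : Type} (z : A) (p : nat -> option nat) (x : nat -> A) (a : nat) : A :=
  match p a with Some b => x b | None => z end.

(** [l'] lists the images of [l] under [p]. The clause on preimages is the invariant that keeps [l']
    duplicate-free when a new image is added. *)
Lemma lsum_pull (p : nat -> option nat) (f : nat -> R) (l : list nat) :
  pinj p -> NoDup l ->
  exists l', NoDup l' /\ (forall b, In b l' -> exists a, In a l /\ p a = Some b) /\
    lsum (pull 0 p f) l = lsum f l'.
Proof.
  intros Hp. induction l as [|i l IH]; intros Hd.
  - exists nil. split; [constructor|]. split; [intros b []|reflexivity].
  - inversion Hd as [|? ? Hn Hd']; subst.
    destruct (IH Hd') as (l' & H1 & H2 & H3).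
    simpl. unfold pull at 1. destruct (p i) as [b|] eqn:E.
    + exists (b :: l'). split; [|split].
      * constructor; trivial. intros Hb. destruct (H2 b Hb) as (a & Ha & Ea).
        rewrite (Hp _ _ _ E Ea) in Hn. contradiction.
      * intros c [<-|Hc]; [exists i; auto|]. destruct (H2 c Hc) as (a & Ha & Ea).
        exists a; auto.
      * simpl. rewrite H3. reflexivity.
    + exists l'. split; [trivial|split].
      * intros c Hc. destruct (H2 c Hc) as (a & Ha & Ea). exists a; auto.
      * rewrite H3. lra.
Qed.

(** Each partial sum of the reindexed series is a sum of [f] over distinct indices, hence at most
    the whole series. This makes reindexing by a partial injection a contraction of the sequence
    space. *)
Lemma Series_pull (p : nat -> option nat) (f : nat -> R) :
  pinj p -> (forall i, 0 <= f i) -> ex_series f ->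
  ex_series (pull 0 p f) /\ Series (pull 0 p f) <= Series f.
Proof.
  intros Hp Hf Hs. apply ex_series_bounded.
  - intros i. unfold pull. destruct (p i); [apply Hf|lra].
  - intros N. rewrite <- lsum_seq.
    destruct (lsum_pull p f (seq 0 (S N)) Hp (seq_NoDup _ _)) as (l' & H1 & _ & ->).
    now apply lsum_le_Series.
Qed.

(** * The Hilbert space of square-summable sequences *)

Definition Csq (z : C) : R := fst z ^ 2 + snd z ^ 2.

Lemma Csq_ge0 (z : C) : 0 <= Csq z.
Proof. unfold Csq. nra. Qed.

Lemma Csq_mul (a b : C) : Csq (Cmul a b) = Csq a * Csq b.
Proof. unfold Csq, Cmul; simpl; ring. Qed.

Lemma Csq_add_le (a b : C) : Csq (Cadd a b) <= 2 * Csq a + 2 * Csq b.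
Proof.
  unfold Csq, Cadd; simpl.
  assert (H1 := pow2_ge_0 (fst a - fst b)). assert (H2 := pow2_ge_0 (snd a - snd b)). nra.
Qed.

(** A crude bound; it serves only to dominate the series that define the inner product. *)
Lemma fst_Cmul_conj_le (a b : C) : Rabs (fst (Cmul a (Cconj b))) <= Csq a + Csq b.
Proof.
  destruct a as [p q], b as [r s]. unfold Csq; simpl. apply Rabs_le.
  assert (H1 := pow2_ge_0 (p - r)). assert (H2 := pow2_ge_0 (p + r)).
  assert (H3 := pow2_ge_0 (q - s)). assert (H4 := pow2_ge_0 (q + s)). split; nra.
Qed.

Lemma snd_Cmul_conj_le (a b : C) : Rabs (snd (Cmul a (Cconj b))) <= Csq a + Csq b.
Proof.
  destruct a as [p q], b as [r s]. unfold Csq; simpl. apply Rabs_le.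
  assert (H1 := pow2_ge_0 (p - s)). assert (H2 := pow2_ge_0 (p + s)).
  assert (H3 := pow2_ge_0 (q - r)). assert (H4 := pow2_ge_0 (q + r)). split; nra.
Qed.

Lemma Csq_eq0 (z : C) : Csq z = 0 -> z = C0.
Proof.
  unfold Csq. intros H. apply injective_projections; apply Rsqr_0_uniq; rewrite Rsqr_pow2;
  assert (H1 := pow2_ge_0 (fst z)); assert (H2 := pow2_ge_0 (snd z)); lra.
Qed.

Lemma Cmod_sq (z : C) : Cmod z ^ 2 = Csq z.
Proof. unfold Cmod. apply pow2_sqrt, Csq_ge0. Qed.

Lemma Cmod_ge0 (z : C) : 0 <= Cmod z.
Proof. apply sqrt_pos. Qed.

Definition sqsum (x : nat -> C) : Prop := ex_series (fun i => Csq (x i)).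

Lemma sqsum_add (x y : nat -> C) :
  sqsum x -> sqsum y -> sqsum (fun i => Cadd (x i) (y i)).
Proof.
  intros Hx Hy.
  apply (ex_series_le (K:=R_AbsRing) (V:=R_CompleteNormedModule) _ (fun i => plus (scal 2 (Csq (x i))) (scal 2 (Csq (y i))))).
  - intros i. change norm with Rabs. rewrite Rabs_pos_eq by apply Csq_ge0.
    apply Csq_add_le.
  - apply (ex_series_plus (V:=R_NormedModule)); apply (ex_series_scal (V:=R_NormedModule)); assumption.
Qed.

Lemma sqsum_scal (a : C) (x : nat -> C) : sqsum x -> sqsum (fun i => Cmul a (x i)).
Proof.
  intros Hx. apply ex_series_ext with (fun i => scal (Csq a) (Csq (x i))).
  - intros i. now rewrite Csq_mul.
  - apply (ex_series_scal (V:=R_NormedModule)). exact Hx.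
Qed.

Lemma sqsum_opp (x : nat -> C) : sqsum x -> sqsum (fun i => Copp (x i)).
Proof.
  intros Hx. apply ex_series_ext with (fun i => Csq (x i)); [|exact Hx].
  intros i. unfold Csq, Copp; simpl; ring.
Qed.

Lemma sqsum_finite (x : nat -> C) (N : nat) :
  (forall i, (N <= i)%nat -> x i = C0) -> sqsum x.
Proof.
  (* Dropping the first [N] terms leaves the zero series. *)
  intros Hx. apply (ex_series_incr_n (V:=R_NormedModule) _ N).
  exists 0. apply is_series_ext with (fun _ => 0).
  - intros i. rewrite Hx by lia. unfold Csq; simpl; ring.
  - change (is_lim_seq (sum_n (fun _ => 0)) 0).
    apply is_lim_seq_ext with (fun _ => 0); [|apply is_lim_seq_const].
    intros m. symmetry. rewrite sum_n_const. ring.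
Qed.

Definition l2 : Type := {x : nat -> C | sqsum x}.
Definition coef (x : l2) : nat -> C := proj1_sig x.

Lemma l2_ext (x y : l2) : (forall i, coef x i = coef y i) -> x = y.
Proof.
  destruct x as [x Hx], y as [y Hy]; simpl. intros H.
  assert (x = y) as <- by now apply functional_extensionality.
  f_equal. apply proof_irrelevance.
Qed.

Lemma sqsum_zero : sqsum (fun _ => C0).
Proof. apply (sqsum_finite _ 0). reflexivity. Qed.

Definition l2_zero : l2 := exist _ _ sqsum_zero.
Definition l2_add (x y : l2) : l2 := exist _ _ (sqsum_add _ _ (proj2_sig x) (proj2_sig y)).
Definition l2_opp (x : l2) : l2 := exist _ _ (sqsum_opp _ (proj2_sig x)).
Definition l2_scal (a : C) (x : l2) : l2 := exist _ _ (sqsum_scal a _ (proj2_sig x)).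
Definition l2_sq (x : l2) : R := Series (fun i => Csq (coef x i)).
Definition l2_norm (x : l2) : R := sqrt (l2_sq x).

Definition l2_inner (x y : l2) : C :=
  (Series (fun i => fst (Cmul (coef x i) (Cconj (coef y i)))),
   Series (fun i => snd (Cmul (coef x i) (Cconj (coef y i))))).

Lemma l2_sq_ge0 (x : l2) : 0 <= l2_sq x.
Proof. apply Series_ge0; [intros; apply Csq_ge0|apply (proj2_sig x)]. Qed.

Lemma l2_norm_sq (x : l2) : l2_norm x ^ 2 = l2_sq x.
Proof. apply pow2_sqrt, l2_sq_ge0. Qed.

Lemma l2_norm_le (x : l2) (B : R) : 0 <= B -> l2_sq x <= B ^ 2 -> l2_norm x <= B.
Proof.
  intros HB H. apply Rsqr_incr_0_var; [|exact HB].
  rewrite 2!Rsqr_pow2, l2_norm_sq. exact H.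
Qed.

Lemma Csq_coef_le (x : l2) (i : nat) : Csq (coef x i) <= l2_sq x.
Proof.
  replace (Csq (coef x i)) with (lsum (fun i => Csq (coef x i)) (i :: nil)) by (simpl; lra).
  apply lsum_le_Series.
  - intros; apply Csq_ge0.
  - apply (proj2_sig x).
  - constructor; [intros []|constructor].
Qed.

Lemma Cmod_coef_le (x : l2) (i : nat) : Cmod (coef x i) <= l2_norm x.
Proof. apply sqrt_le_1_alt, Csq_coef_le. Qed.

Lemma ex_series_inner (x y : l2) :
  ex_series (fun i => fst (Cmul (coef x i) (Cconj (coef y i)))) /\
  ex_series (fun i => snd (Cmul (coef x i) (Cconj (coef y i)))).
Proof.
  assert (H : ex_series (fun i => plus (Csq (coef x i)) (Csq (coef y i)))).
  { apply (ex_series_plus (V:=R_NormedModule)); [apply (proj2_sig x)|apply (proj2_sig y)]. }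
  split;
  apply (ex_series_le (K:=R_AbsRing) (V:=R_CompleteNormedModule) _
    (fun i => plus (Csq (coef x i)) (Csq (coef y i)))); try exact H;
  intros i; change norm with Rabs; [apply fst_Cmul_conj_le|apply snd_Cmul_conj_le].
Qed.

Lemma l2_inner_add_l (x y z : l2) :
  l2_inner (l2_add x y) z = Cadd (l2_inner x z) (l2_inner y z).
Proof.
  destruct (ex_series_inner x z) as [H1 H2]. destruct (ex_series_inner y z) as [H3 H4].
  apply injective_projections; unfold l2_inner, Cadd; cbn [fst snd].
  - rewrite <- Series_plus by assumption. apply Series_ext. intros i. unfold coef; simpl. ring.
  - rewrite <- Series_plus by assumption. apply Series_ext. intros i. unfold coef; simpl. ring.
Qed.

Lemma l2_inner_scal_l (a : C) (x y : l2) :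
  l2_inner (l2_scal a x) y = Cmul a (l2_inner x y).
Proof.
  destruct (ex_series_inner x y) as [H1 H2].
  apply injective_projections; unfold Cmul; unfold l2_inner; cbn [fst snd].
  - rewrite <- 2!Series_scal_l, <- Series_minus.
    + apply Series_ext. intros i. unfold coef; simpl. ring.
    + apply (ex_series_scal (V:=R_NormedModule) (fst a)); assumption.
    + apply (ex_series_scal (V:=R_NormedModule) (snd a)); assumption.
  - rewrite <- 2!Series_scal_l, <- Series_plus.
    + apply Series_ext. intros i. unfold coef; simpl. ring.
    + apply (ex_series_scal (V:=R_NormedModule) (fst a)); assumption.
    + apply (ex_series_scal (V:=R_NormedModule) (snd a)); assumption.
Qed.

Lemma l2_inner_conj_sym (x y : l2) : l2_inner y x = Cconj (l2_inner x y).
Proof.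
  apply injective_projections; unfold Cconj; unfold l2_inner; cbn [fst snd].
  - apply Series_ext. intros i. unfold coef; simpl. ring.
  - rewrite <- Series_opp. apply Series_ext. intros i. unfold coef; simpl. ring.
Qed.

Lemma l2_inner_norm (x : l2) : l2_inner x x = (l2_norm x ^ 2, 0).
Proof.
  rewrite l2_norm_sq.
  apply injective_projections; unfold l2_inner, l2_sq; cbn [fst snd].
  - apply Series_ext. intros i. unfold Csq, coef; simpl. ring.
  - rewrite (Series_ext _ (fun _ => 0 * 0)).
    + rewrite Series_scal_l. ring.
    + intros i. unfold coef; simpl. ring.
Qed.

Lemma l2_norm_eq0 (x : l2) : l2_norm x = 0 -> x = l2_zero.
Proof.
  intros H. apply l2_ext. intros i. apply Csq_eq0.
  assert (H1 := Csq_coef_le x i). assert (H2 := Csq_ge0 (coef x i)).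
  rewrite <- l2_norm_sq, H in H1. lra.
Qed.

Lemma l2_norm_scal (a : C) (x : l2) : l2_norm (l2_scal a x) = Cmod a * l2_norm x.
Proof.
  unfold l2_norm, l2_sq, Cmod.
  rewrite <- sqrt_mult; [|apply Csq_ge0|apply l2_sq_ge0].
  f_equal. unfold l2_sq. fold (Csq a). rewrite <- Series_scal_l. apply Series_ext.
  intros i. apply Csq_mul.
Qed.

(** Cauchy-Schwarz for the real part: expanding a square gives 2 Re <x,y> <= t |x|^2 + |y|^2 / t for
    every t > 0, and a suitable t finishes each case. *)
Lemma l2_inner_le (x y : l2) : fst (l2_inner x y) <= l2_norm x * l2_norm y.
Proof.
  assert (Hx : 0 <= l2_norm x) by apply sqrt_pos.
  assert (Hy : 0 <= l2_norm y) by apply sqrt_pos.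
  assert (Ht : forall t, 0 < t ->
            2 * fst (l2_inner x y) <= t * l2_norm x ^ 2 + / t * l2_norm y ^ 2).
  { intros t Ht. rewrite 2!l2_norm_sq. unfold l2_sq, l2_inner; cbn [fst].
    rewrite <- 3!Series_scal_l, <- Series_plus.
    - apply Rminus_le_0. rewrite <- Series_minus.
      + apply Series_ge0.
        * intros i. unfold Cmul, Cconj, Csq; simpl.
          set (a := fst (coef x i)). set (b := snd (coef x i)).
          set (c := fst (coef y i)). set (d := snd (coef y i)).
          replace (_ - _) with (/ t * ((t * a - c) ^ 2 + (t * b - d) ^ 2)) by (field; lra).
          apply Rmult_le_pos; [left; now apply Rinv_0_lt_compat|].
          apply Rplus_le_le_0_compat; apply pow2_ge_0.
        * apply (ex_series_minus (V:=R_NormedModule)).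
          -- apply (ex_series_plus (V:=R_NormedModule)).
             ++ apply (ex_series_scal (V:=R_NormedModule) t), (proj2_sig x).
             ++ apply (ex_series_scal (V:=R_NormedModule) (/ t)), (proj2_sig y).
          -- apply (ex_series_scal (V:=R_NormedModule) 2). apply ex_series_inner.
      + apply (ex_series_plus (V:=R_NormedModule)).
        * apply (ex_series_scal (V:=R_NormedModule) t), (proj2_sig x).
        * apply (ex_series_scal (V:=R_NormedModule) (/ t)), (proj2_sig y).
      + apply (ex_series_scal (V:=R_NormedModule) 2). apply ex_series_inner.
    - apply (ex_series_scal (V:=R_NormedModule) t), (proj2_sig x).
    - apply (ex_series_scal (V:=R_NormedModule) (/ t)), (proj2_sig y). }
  apply Rnot_lt_le. intros Hlt.
  set (g := fst (l2_inner x y)) in *. set (p := l2_norm x) in *. set (q := l2_norm y) in *.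
  assert (Hg : 0 < g) by nra.
  destruct (Req_dec p 0) as [Hp|Hp]; [|destruct (Req_dec q 0) as [Hq|Hq]].
  (* With p = 0 this t makes the right-hand side g q^2 / (q^2 + 1), which is below g and contradicts
     2 g. *)
  - specialize (Ht ((q ^ 2 + 1) / g)).
    assert (Hq : 0 < (q ^ 2 + 1) / g) by (apply Rdiv_lt_0_compat; nra).
    specialize (Ht Hq). rewrite Hp in Ht.
    assert (/ ((q ^ 2 + 1) / g) * q ^ 2 <= g); [|nra].
    replace (/ ((q ^ 2 + 1) / g) * q ^ 2) with (g - g / (q ^ 2 + 1)) by (field; nra).
    assert (0 < g / (q ^ 2 + 1)) by (apply Rdiv_lt_0_compat; nra). lra.
  (* With q = 0 this t keeps the right-hand side below g. *)
  - specialize (Ht (g / (p ^ 2 + 1))).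
    assert (Hp' : 0 < g / (p ^ 2 + 1)) by (apply Rdiv_lt_0_compat; nra).
    specialize (Ht Hp'). rewrite Hq in Ht.
    assert (g / (p ^ 2 + 1) * p ^ 2 <= g); [|nra].
    replace (g / (p ^ 2 + 1) * p ^ 2) with (g - g / (p ^ 2 + 1)) by (field; nra). lra.
  (* The minimising t, for which the right-hand side is 2 p q. *)
  - specialize (Ht (q / p)).
    assert (Hqp : 0 < q / p) by (apply Rdiv_lt_0_compat; lra).
    specialize (Ht Hqp).
    replace (q / p * p ^ 2 + / (q / p) * q ^ 2) with (2 * (p * q)) in Ht by (field; lra).
    lra.
Qed.

Lemma l2_norm_triangle (x y : l2) : l2_norm (l2_add x y) <= l2_norm x + l2_norm y.
Proof.
  assert (Hx : 0 <= l2_norm x) by apply sqrt_pos.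
  assert (Hy : 0 <= l2_norm y) by apply sqrt_pos.
  apply l2_norm_le; [lra|].
  assert (H : l2_sq (l2_add x y) = l2_sq x + l2_sq y + 2 * fst (l2_inner x y)).
  { unfold l2_sq, l2_inner; cbn [fst].
    rewrite <- Series_scal_l, <- 2!Series_plus.
    - apply Series_ext. intros i. unfold Csq, coef; simpl. ring.
    - apply (ex_series_plus (V:=R_NormedModule)); [apply (proj2_sig x)|apply (proj2_sig y)].
    - apply (ex_series_scal (V:=R_NormedModule) 2). apply ex_series_inner.
    - apply (proj2_sig x).
    - apply (proj2_sig y). }
  rewrite H, <- 2!l2_norm_sq. assert (Hi := l2_inner_le x y). nra.
Qed.

(** Closed by [Defined], so that the carrier and the operations unfold by conversion in later
    proofs. *)
Definition l2_space : CNormedSpace.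
Proof.
  refine {| carrier := l2; vzero := l2_zero; vadd := l2_add; vopp := l2_opp;
            vscal := l2_scal; vnorm := l2_norm;
            vnorm_eq0 := l2_norm_eq0; vnorm_scal := l2_norm_scal;
            vnorm_triangle := l2_norm_triangle |}; intros;
  try (apply l2_ext; intros i; apply injective_projections; unfold coef; simpl; ring).
  apply sqrt_pos.
Defined.

(** * Completeness of the sequence space *)

Lemma R_cauchy_cv (u : nat -> R) :
  (forall eps, 0 < eps -> exists N, forall p q, (N <= p)%nat -> (N <= q)%nat ->
    Rabs (u p - u q) < eps) -> exists l : R, is_lim_seq u l.
Proof.
  intros H. destruct (Rcomplete.R_complete u) as [l Hl].
  - intros eps Heps. destruct (H eps Heps) as [N HN]. exists N. intros p q Hp Hq.
    apply HN; lia.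
  - exists l. now apply is_lim_seq_Reals.
Qed.

Lemma fst_le_Cmod (z : C) : Rabs (fst z) <= Cmod z.
Proof. rewrite <- sqrt_Rsqr_abs. apply sqrt_le_1_alt. unfold Rsqr. nra. Qed.

Lemma snd_le_Cmod (z : C) : Rabs (snd z) <= Cmod z.
Proof. rewrite <- sqrt_Rsqr_abs. apply sqrt_le_1_alt. unfold Rsqr. nra. Qed.

(** Coordinates converge because they are dominated by the norm. Norm convergence follows by letting
    q tend to infinity in the finite partial sums of |u_p - u_q|^2, with a bound uniform in the
    number of terms. *)
Lemma l2_complete : complete l2_space.
Proof.
  intros u Hu.
  assert (Hc : forall i eps, 0 < eps -> exists N, forall p q, (N <= p)%nat -> (N <= q)%nat ->
            Cmod (Cadd (coef (u p) i) (Copp (coef (u q) i))) < eps).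
  { intros i eps Heps. destruct (Hu eps Heps) as [N HN]. exists N. intros p q Hp Hq.
    apply Rle_lt_trans with (2 := HN p q Hp Hq).
    apply (Cmod_coef_le (l2_add (u p) (l2_opp (u q)))). }
  assert (Hl : forall i, exists l : C, is_lim_seq (fun p => fst (coef (u p) i)) (fst l) /\
                                   is_lim_seq (fun p => snd (coef (u p) i)) (snd l)).
  { intros i.
    destruct (R_cauchy_cv (fun p => fst (coef (u p) i))) as [a Ha].
    { intros eps Heps. destruct (Hc i eps Heps) as [N HN]. exists N. intros p q Hp Hq.
      apply Rle_lt_trans with (2 := HN p q Hp Hq).
      apply (fst_le_Cmod (Cadd (coef (u p) i) (Copp (coef (u q) i)))). }
    destruct (R_cauchy_cv (fun p => snd (coef (u p) i))) as [b Hb].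
    { intros eps Heps. destruct (Hc i eps Heps) as [N HN]. exists N. intros p q Hp Hq.
      apply Rle_lt_trans with (2 := HN p q Hp Hq).
      apply (snd_le_Cmod (Cadd (coef (u p) i) (Copp (coef (u q) i)))). }
    exists (a, b). auto. }
  destruct (choice _ Hl) as [l Hlim].
  assert (Hd : forall eps, 0 < eps -> exists N, forall p, (N <= p)%nat -> forall M,
            sum_n (fun i => Csq (Cadd (coef (u p) i) (Copp (l i)))) M <= eps ^ 2).
  { intros eps Heps. destruct (Hu eps Heps) as [N HN]. exists N. intros p Hp M.
    assert (Hcv : is_lim_seq (fun q => sum_n (fun i => Csq (Cadd (coef (u p) i) (Copp (coef (u q) i)))) M)
              (sum_n (fun i => Csq (Cadd (coef (u p) i) (Copp (l i)))) M)).
    { assert (Hi : forall i, is_lim_seq (fun q => Csq (Cadd (coef (u p) i) (Copp (coef (u q) i))))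
                 (Csq (Cadd (coef (u p) i) (Copp (l i))))).
      { intros i. destruct (Hlim i) as [H1 H2]. unfold Csq, Cadd, Copp; cbn [fst snd].
        apply is_lim_seq_plus'.
        - apply (is_lim_seq_continuous (fun t => (fst (coef (u p) i) + - t) ^ 2)); [|exact H1].
          apply derivable_continuous_pt. reg.
        - apply (is_lim_seq_continuous (fun t => (snd (coef (u p) i) + - t) ^ 2)); [|exact H2].
          apply derivable_continuous_pt. reg. }
      induction M as [|M IH].
      - rewrite sum_O. apply is_lim_seq_ext with (2 := Hi 0%nat).
        intros q. now rewrite sum_O.
      - rewrite sum_Sn. apply is_lim_seq_ext with (2 := is_lim_seq_plus' _ _ _ _ IH (Hi (S M))).
        intros q. now rewrite sum_Sn. }
    refine (is_lim_seq_le_loc _ (fun _ => eps ^ 2) _ (eps ^ 2) _ Hcv (is_lim_seq_const _)).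
    exists N. intros q Hq. specialize (HN p q Hp Hq).
    set (y := l2_add (u p) (l2_opp (u q))).
    apply Rle_trans with (l2_sq y).
    - apply (sum_n_le_Series (fun i => Csq (coef y i))); [intros; apply Csq_ge0|apply (proj2_sig y)].
    - rewrite <- l2_norm_sq. apply pow_incr. split; [apply sqrt_pos|].
      left. exact HN. }
  (* The limit is the difference of the square-summable sequences [u N] and [u N] - [l]. *)
  assert (Hls : sqsum l).
  { destruct (Hd 1 Rlt_0_1) as [N HN].
    destruct (ex_series_bounded (fun i => Csq (Cadd (coef (u N) i) (Copp (l i)))) (1 ^ 2)) as [H _].
    - intros; apply Csq_ge0.
    - apply HN. lia.
    - assert (H' := sqsum_add _ _ (proj2_sig (u N)) (sqsum_opp _ H)).
      revert H'. apply ex_series_ext. intros i. f_equal.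
      apply injective_projections; simpl; fold (coef (u N)); ring. }
  exists (exist _ l Hls). intros eps Heps.
  (* The limit passage gives only a weak inequality, so half of [eps] is used. *)
  destruct (Hd (eps / 2)) as [N HN]; [lra|]. exists N. intros p Hp.
  apply Rle_lt_trans with (eps / 2); [|lra].
  apply l2_norm_le; [lra|].
  apply (ex_series_bounded (fun i => Csq (Cadd (coef (u p) i) (Copp (l i))))).
  - intros; apply Csq_ge0.
  - now apply HN.
Qed.

(** * Separability and infinite dimension of the sequence space *)

(** The numerator is a difference of naturals, so every sign occurs; the shift by 1 keeps the
    denominator positive. *)
Definition rat_code (k : nat) : R :=
  let (a, bc) := Cantor.of_nat k in let (b, c) := Cantor.of_nat bc in
  (INR a - INR b) / (INR c + 1).

Lemma rat_code_dense (r eps : R) : 0 < eps -> exists k, Rabs (r - rat_code k) < eps.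
Proof.
  intros Heps. destruct (archimed_cor1 eps Heps) as (c & Hc & Hc0).
  assert (Hp : 0 < INR c + 1) by (assert (H := pos_INR c); lra).
  set (z := up (r * (INR c + 1))).
  (* At least one of [Z.to_nat z] and [Z.to_nat (- z)] is 0, so their difference is [z]. *)
  exists (Cantor.to_nat (Z.to_nat z, Cantor.to_nat (Z.to_nat (- z), c))).
  unfold rat_code. rewrite 2!Cantor.cancel_of_to.
  assert (Hz : INR (Z.to_nat z) - INR (Z.to_nat (- z)) = IZR z).
  { rewrite 2!INR_IZR_INZ, <- minus_IZR. f_equal. lia. }
  rewrite Hz. destruct (archimed (r * (INR c + 1))) as [H1 H2]. fold z in H1, H2.
  replace (r - IZR z / (INR c + 1)) with (- ((IZR z - r * (INR c + 1)) / (INR c + 1)))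
    by (field; lra).
  rewrite Rabs_Ropp, Rabs_pos_eq.
  - apply Rle_lt_trans with (2 := Hc). apply Rle_trans with (1 / (INR c + 1)).
    + apply Rmult_le_compat_r; [left; now apply Rinv_0_lt_compat|lra].
    + unfold Rdiv. rewrite Rmult_1_l. apply Rinv_le_contravar; [now apply lt_0_INR|lra].
  - apply Rmult_le_pos; [lra|left; now apply Rinv_0_lt_compat].
Qed.

Definition complex_code (k : nat) : C :=
  let (a, b) := Cantor.of_nat k in (rat_code a, rat_code b).

Lemma complex_code_dense (z : C) (eps : R) :
  0 < eps -> exists k, Csq (Cadd z (Copp (complex_code k))) <= eps.
Proof.
  (* Since d <= 1 and d <= eps / 2, the squared error is at most 2 d^2 <= 2 d <= eps. *)
  intros Heps. set (d := Rmin 1 (eps / 2)).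
  assert (Hd : 0 < d) by (apply Rmin_glb_lt; lra).
  assert (Hd1 : d <= 1) by apply Rmin_l. assert (Hd2 : d <= eps / 2) by apply Rmin_r.
  destruct (rat_code_dense (fst z) d Hd) as [a Ha].
  destruct (rat_code_dense (snd z) d Hd) as [b Hb].
  exists (Cantor.to_nat (a, b)).
  unfold complex_code. rewrite Cantor.cancel_of_to. unfold Csq; simpl.
  apply Rabs_def2 in Ha. apply Rabs_def2 in Hb. nra.
Qed.

(** Iterated Cantor unpairing reads one natural number as an infinite sequence of naturals; every
    finite prefix is realised by some number. *)
Definition digit (r i : nat) : nat :=
  fst (Cantor.of_nat (Nat.iter i (fun s => snd (Cantor.of_nat s)) r)).

Lemma digit_surj (m : nat) (c : nat -> nat) :
  exists r, forall i, (i < m)%nat -> digit r i = c i.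
Proof.
  revert c. induction m as [|m IH]; intros c; [exists 0%nat; lia|].
  destruct (IH (fun i => c (S i))) as [r Hr].
  exists (Cantor.to_nat (c 0%nat, r)). intros [|i] Hi; unfold digit.
  - cbn [Nat.iter nat_rect]. now rewrite Cantor.cancel_of_to.
  - rewrite Nat.iter_succ_r. cbv beta. rewrite Cantor.cancel_of_to. apply (Hr i). lia.
Qed.

(** The code [k] packs a support length with the codes of the coordinates: this enumerates the
    finitely supported sequences with rational real and imaginary parts. *)
Definition dense_fun (k i : nat) : C :=
  let (m, r) := Cantor.of_nat k in
  if (i <? m)%nat then complex_code (digit r i) else C0.

Lemma sqsum_dense_fun (k : nat) : sqsum (dense_fun k).
Proof.
  unfold dense_fun. destruct (Cantor.of_nat k) as [m r].
  apply (sqsum_finite _ m). intros i Hi. now rewrite (proj2 (Nat.ltb_ge i m) Hi).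
Qed.

Definition dense_seq (k : nat) : l2 := exist _ _ (sqsum_dense_fun k).

Lemma l2_separable : separable l2_space.
Proof.
  exists dense_seq. intros x eps Heps.
  set (f := fun i => Csq (coef x i)). set (e := eps ^ 2 / 4).
  assert (He : 0 < e) by (unfold e; nra).
  assert (HL : is_lim_seq (sum_n f) (Series f)) by apply (Series_correct f), (proj2_sig x).
  apply is_lim_seq_Reals in HL. destruct (HL e He) as [K HK].
  (* The errors allowed in the coordinates form a geometric series of total [e]. *)
  assert (Hc : forall i, exists k,
            Csq (Cadd (coef x i) (Copp (complex_code k))) <= e * (/ 2) ^ (S i)).
  { intros i. apply complex_code_dense. apply Rmult_lt_0_compat; [exact He|].
    apply pow_lt. lra. }
  destruct (choice _ Hc) as [c Hcode].
  destruct (digit_surj (S K) c) as [r Hr].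
  exists (Cantor.to_nat (S K, r)).
  set (y := dense_seq _).
  set (g := fun i => Csq (Cadd (coef x i) (Copp (coef y i)))).
  assert (Hy : forall i, coef y i = if (i <? S K)%nat then complex_code (c i) else C0).
  { intros i. unfold y, dense_seq, coef, proj1_sig, dense_fun. rewrite Cantor.cancel_of_to.
    destruct (Nat.ltb_spec i (S K)); [now rewrite Hr|reflexivity]. }
  assert (Hg1 : forall i, (i <= K)%nat -> g i <= e * (/ 2) ^ (S i)).
  { intros i Hi. unfold g. rewrite Hy, (proj2 (Nat.ltb_lt i (S K))) by lia. apply Hcode. }
  assert (Hg2 : forall i, (K < i)%nat -> g i = f i).
  { intros i Hi. unfold g, f. rewrite Hy, (proj2 (Nat.ltb_ge i (S K))) by lia.
    f_equal. apply injective_projections; simpl; ring. }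
  (* Coordinates up to [K] contribute at most the geometric part; beyond [K] the approximant
     vanishes and the terms of [f] remain. *)
  assert (Hsum : forall M, sum_n g M <= e * (1 - (/ 2) ^ (S M)) + (sum_n f M - sum_n f (min M K))).
  { induction M as [|M IH].
    - rewrite Nat.min_0_l, !sum_O. assert (H := Hg1 0%nat ltac:(lia)).
      simpl in *. lra.
    - rewrite 2!sum_Sn. unfold plus; simpl AbelianMonoid.plus.
      destruct (le_lt_dec (S M) K) as [Hle|Hlt].
      + rewrite Nat.min_l in * by lia. rewrite sum_Sn. unfold plus; simpl AbelianMonoid.plus.
        assert (H := Hg1 (S M) Hle). simpl in *. lra.
      + rewrite Nat.min_r in * by lia. rewrite (Hg2 (S M)) by lia.
        assert (0 < (/ 2) ^ (S M)) by (apply pow_lt; lra). simpl in *. nra. }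
  (* The two errors total 2 e = eps^2 / 2 <= (3 eps / 4)^2, which leaves room for the strict
     inequality. *)
  apply Rle_lt_trans with (3 / 4 * eps); [|lra].
  apply l2_norm_le; [lra|]. apply Rle_trans with (e + e); [|unfold e; nra].
  apply (ex_series_bounded g); [intros; apply Csq_ge0|].
  intros M. apply Rle_trans with (1 := Hsum M).
  assert (0 < (/ 2) ^ (S M)) by (apply pow_lt; lra).
  assert (sum_n f M - sum_n f (min M K) <= e); [|nra].
  destruct (le_lt_dec M K) as [Hle|Hlt].
  - rewrite Nat.min_l by lia. lra.
  - rewrite Nat.min_r by lia. specialize (HK K ltac:(lia)).
    unfold Rdist in HK. apply Rabs_def2 in HK.
    assert (sum_n f M <= Series f); [|lra].
    apply sum_n_le_Series; [intros; apply Csq_ge0|apply (proj2_sig x)].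
Qed.

Definition l2_Banach : SepBanach :=
  {| sb_space := l2_space; sb_complete := l2_complete; sb_separable := l2_separable |}.

Definition l2_Hilbert : SepHilbert :=
  {| sh_space := l2_Banach; inner := l2_inner; inner_add_l := l2_inner_add_l;
     inner_scal_l := l2_inner_scal_l; inner_conj_sym := l2_inner_conj_sym;
     inner_norm := l2_inner_norm |}.

Definition delta_fun (k i : nat) : C := if (i =? k)%nat then C1 else C0.

Lemma sqsum_delta_fun (k : nat) : sqsum (delta_fun k).
Proof.
  apply (sqsum_finite _ (S k)). intros i Hi. unfold delta_fun.
  now rewrite (proj2 (Nat.eqb_neq i k)) by lia.
Qed.

Definition delta (k : nat) : l2 := exist _ _ (sqsum_delta_fun k).

Lemma l2_infinite_dimensional : infinite_dimensional l2_space.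
Proof.
  intros m. exists delta. intros c Hc.
  assert (H : forall i, coef (lincomb (X := l2_space) c delta m) i = if (i <? m)%nat then c i else C0).
  { clear Hc. intros i. induction m as [|m IH]; [reflexivity|].
    change (coef (lincomb (X := l2_space) c delta (S m)) i) with
      (Cadd (coef (lincomb (X := l2_space) c delta m) i) (Cmul (c m) (delta_fun m i))).
    rewrite IH. unfold delta_fun.
    destruct (Nat.ltb_spec i m), (Nat.ltb_spec i (S m)), (Nat.eqb_spec i m); try lia;
      subst; apply injective_projections; simpl; ring. }
  intros i Hi. rewrite Hc in H. specialize (H i).
  rewrite (proj2 (Nat.ltb_lt i m) Hi) in H. symmetry. exact H.
Qed.

(** * Normed spaces and strong limits of operators *)

Section NormedSpace.

Variable X : CNormedSpace.
Implicit Types x y z : X.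

Lemma vadd_cancel_r x y z : vadd x z = vadd y z -> x = y.
Proof.
  intros H. rewrite <- (vadd_zero _ x), <- (vadd_zero _ y), <- (vadd_opp _ z).
  now rewrite 2!vadd_assoc, H.
Qed.

Lemma vscal_0 x : vscal C0 x = vzero.
Proof.
  apply vadd_cancel_r with (vscal C0 x). rewrite <- vscal_distr_c, (vadd_comm _ vzero), vadd_zero.
  f_equal. apply injective_projections; simpl; ring.
Qed.

Lemma vscal_m1 x : vscal (Copp C1) x = vopp x.
Proof.
  apply vadd_cancel_r with x. rewrite (vadd_comm _ (vopp x)), vadd_opp.
  rewrite <- (vscal_one _ x) at 2. rewrite <- vscal_distr_c, <- (vscal_0 x).
  f_equal. apply injective_projections; simpl; ring.
Qed.

Lemma vsub_cancel x : vsub x x = vzero.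
Proof. apply vadd_opp. Qed.

Lemma vsub_zero_eq x y : vsub x y = vzero -> x = y.
Proof. intros H. apply vadd_cancel_r with (vopp y). now rewrite vadd_opp. Qed.

Lemma vnorm_zero : vnorm (vzero : X) = 0.
Proof.
  rewrite <- (vscal_0 vzero), vnorm_scal. unfold Cmod, C0; simpl.
  replace (0 * (0 * 1) + 0 * (0 * 1)) with 0 by ring. rewrite sqrt_0. ring.
Qed.

Lemma Cmod_m1 : Cmod (Copp C1) = 1.
Proof.
  transitivity (sqrt 1); [|apply sqrt_1]. unfold Cmod. f_equal. simpl. ring.
Qed.

Lemma vnorm_opp x : vnorm (vopp x) = vnorm x.
Proof. rewrite <- vscal_m1, vnorm_scal, Cmod_m1. ring. Qed.

Lemma vopp_add x y : vopp (vadd x y) = vadd (vopp x) (vopp y).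
Proof. now rewrite <- 3!vscal_m1, vscal_distr_v. Qed.

Lemma vopp_opp x : vopp (vopp x) = x.
Proof. apply vadd_cancel_r with (vopp x). now rewrite (vadd_comm _ (vopp (vopp x))), 2!vadd_opp. Qed.

Lemma vadd_ACA x y z (t : X) : vadd (vadd x y) (vadd z t) = vadd (vadd x z) (vadd y t).
Proof. rewrite <- 2!vadd_assoc, (vadd_assoc _ y), (vadd_comm _ y z), <- vadd_assoc. reflexivity. Qed.

Lemma vsub_split x y z : vsub x z = vadd (vsub x y) (vsub y z).
Proof.
  unfold vsub. now rewrite vadd_ACA, (vadd_comm _ (vopp y)), <- vadd_ACA, vadd_opp, vadd_zero.
Qed.

Lemma vnorm_vsub_sym x y : vnorm (vsub x y) = vnorm (vsub y x).
Proof.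
  rewrite <- (vnorm_opp (vsub y x)). unfold vsub. now rewrite vopp_add, vopp_opp, vadd_comm.
Qed.

Lemma vnorm_vsub_triangle x y z : vnorm (vsub x z) <= vnorm (vsub x y) + vnorm (vsub y z).
Proof. rewrite (vsub_split x y z). apply vnorm_triangle. Qed.

Lemma vnorm_vsub_le x y : vnorm x <= vnorm y + vnorm (vsub x y).
Proof.
  assert (H : x = vadd (vsub x y) y).
  { unfold vsub. now rewrite <- vadd_assoc, (vadd_comm _ (vopp y)), vadd_opp, vadd_zero. }
  rewrite H at 1. rewrite Rplus_comm. apply vnorm_triangle.
Qed.

Lemma vsub_add x y z (t : X) : vsub (vadd x y) (vadd z t) = vadd (vsub x z) (vsub y t).
Proof. unfold vsub. now rewrite vopp_add, vadd_ACA. Qed.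

Lemma vsub_scal (a : C) x y : vsub (vscal a x) (vscal a y) = vscal a (vsub x y).
Proof.
  unfold vsub. rewrite vscal_distr_v. f_equal. rewrite <- 2!vscal_m1, 2!vscal_assoc.
  f_equal. apply injective_projections; simpl; ring.
Qed.

Lemma vsub_scal_l (a b : C) x : vsub (vscal a x) (vscal b x) = vscal (Cadd a (Copp b)) x.
Proof.
  rewrite vscal_distr_c. unfold vsub. f_equal. rewrite <- vscal_m1, vscal_assoc.
  f_equal. apply injective_projections; simpl; ring.
Qed.

Definition additive (S : X -> X) : Prop := forall x y, S (vadd x y) = vadd (S x) (S y).
Definition homogeneous (S : X -> X) : Prop := forall a x, S (vscal a x) = vscal a (S x).

Lemma linear_vsub (S : X -> X) x y :
  additive S -> homogeneous S -> S (vsub x y) = vsub (S x) (S y).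
Proof. intros H1 H2. unfold vsub. now rewrite H1, <- 2!vscal_m1, H2. Qed.

Lemma converges_to_unique (u : nat -> X) (l l' : X) :
  converges_to u l -> converges_to u l' -> l = l'.
Proof.
  intros H H'. apply vsub_zero_eq, vnorm_eq0.
  destruct (Rle_lt_or_eq_dec 0 _ (vnorm_nonneg X (vsub l l'))) as [Hlt|]; [|easy].
  destruct (H (vnorm (vsub l l') / 2)) as [N HN]; [lra|].
  destruct (H' (vnorm (vsub l l') / 2)) as [N' HN']; [lra|].
  specialize (HN (max N N') ltac:(lia)). specialize (HN' (max N N') ltac:(lia)).
  assert (Ht := vnorm_vsub_triangle l (u (max N N')) l').
  rewrite (vnorm_vsub_sym l (u _)) in Ht. lra.
Qed.

Lemma converges_to_vnorm_le (u : nat -> X) (l : X) (B : R) :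
  converges_to u l -> (forall m, vnorm (u m) <= B) -> vnorm l <= B.
Proof.
  intros H HB. apply le_epsilon. intros eps Heps. destruct (H eps Heps) as [N HN].
  specialize (HN N ltac:(lia)). specialize (HB N).
  assert (Ht := vnorm_vsub_le l (u N)). rewrite vnorm_vsub_sym in Ht. lra.
Qed.

Lemma converges_to_add (u v : nat -> X) (l l' : X) :
  converges_to u l -> converges_to v l' ->
  converges_to (fun m => vadd (u m) (v m)) (vadd l l').
Proof.
  intros H H' eps Heps. destruct (H (eps / 2)) as [N HN]; [lra|].
  destruct (H' (eps / 2)) as [N' HN']; [lra|]. exists (max N N'). intros p Hp.
  specialize (HN p ltac:(lia)). specialize (HN' p ltac:(lia)).
  rewrite vsub_add. assert (Ht := vnorm_triangle X (vsub (u p) l) (vsub (v p) l')). lra.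
Qed.

Lemma converges_to_scal (a : C) (u : nat -> X) (l : X) :
  converges_to u l -> converges_to (fun m => vscal a (u m)) (vscal a l).
Proof.
  intros H eps Heps. assert (Ha := Cmod_ge0 a).
  destruct (H (eps / (Cmod a + 1))) as [N HN]; [apply Rdiv_lt_0_compat; lra|].
  exists N. intros p Hp. specialize (HN p Hp). rewrite vsub_scal, vnorm_scal.
  apply (Rmult_lt_compat_l (Cmod a + 1)) in HN; [|lra].
  replace ((Cmod a + 1) * (eps / (Cmod a + 1))) with eps in HN by (field; lra).
  assert (H0 := vnorm_nonneg X (vsub (u p) l)). nra.
Qed.

Lemma geometric_increment (u : nat -> X) (K : R) (p q : nat) :
  0 <= K -> (forall m, vnorm (vsub (u (S m)) (u m)) <= K * (/ 2) ^ m) -> (p <= q)%nat ->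
  vnorm (vsub (u q) (u p)) <= 2 * K * (/ 2) ^ p.
Proof.
  intros HK Hu Hpq.
  (* Keeping the term in 2^-q makes the bound telescope in the induction. *)
  assert (H : vnorm (vsub (u q) (u p)) <= 2 * K * ((/ 2) ^ p - (/ 2) ^ q)).
  { induction Hpq as [|q Hpq IH].
    - rewrite vsub_cancel, vnorm_zero. lra.
    - assert (Ht := vnorm_vsub_triangle (u (S q)) (u q) (u p)). specialize (Hu q).
      simpl. lra. }
  assert (0 < (/ 2) ^ q) by (apply pow_lt; lra). nra.
Qed.

Lemma half_pow_small (eps : R) : 0 < eps -> exists N, (/ 2) ^ N < eps.
Proof.
  intros Heps. destruct (pow_lt_1_zero (/ 2)) with (y := eps) as [N HN]; trivial.
  - rewrite Rabs_pos_eq; lra.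
  - exists N. specialize (HN N (le_n N)). rewrite Rabs_pos_eq in HN; [exact HN|].
    apply pow_le; lra.
Qed.

Lemma geometric_cauchy (u : nat -> X) (K : R) :
  0 <= K -> (forall m, vnorm (vsub (u (S m)) (u m)) <= K * (/ 2) ^ m) -> cauchy_seq u.
Proof.
  intros HK Hu eps Heps.
  destruct (half_pow_small (eps / (4 * K + 1))) as [N HN]; [apply Rdiv_lt_0_compat; lra|].
  exists N. intros p q Hp Hq.
  assert (H1 := geometric_increment u K N p HK Hu Hp).
  assert (H2 := geometric_increment u K N q HK Hu Hq).
  assert (Ht := vnorm_vsub_triangle (u p) (u N) (u q)). rewrite (vnorm_vsub_sym (u N) (u q)) in Ht.
  apply (Rmult_lt_compat_l (4 * K + 1)) in HN; [|lra].
  replace ((4 * K + 1) * (eps / (4 * K + 1))) with eps in HN by (field; lra).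
  assert (0 < (/ 2) ^ N) by (apply pow_lt; lra). nra.
Qed.

(** A uniformly bounded sequence of linear operators; it will be instantiated with the finite
    products of twists. *)
Variables (S : nat -> X -> X) (B : R).
Hypothesis S_add : forall m, additive (S m).
Hypothesis S_scal : forall m, homogeneous (S m).
Hypothesis S_bound : forall m x, vnorm (S m x) <= B * vnorm x.

(** Choice selects the pointwise limits; uniqueness of limits gives linearity, and the norm bound
    passes to the limit. *)
Lemma strong_limit :
  complete X -> (forall x, cauchy_seq (fun m => S m x)) ->
  exists T : X -> X, bounded_operator T /\ forall x, converges_to (fun m => S m x) (T x).
Proof.
  intros HX HS.
  destruct (choice (fun x l => converges_to (fun m => S m x) l)) as [T HT].
  { intros x. apply HX, HS. }
  exists T. split; [|exact HT]. split; [|split].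
  - intros x y. apply converges_to_unique with (1 := HT (vadd x y)).
    intros eps Heps. destruct (converges_to_add _ _ _ _ (HT x) (HT y) eps Heps) as [N HN].
    exists N. intros p Hp. rewrite S_add. now apply HN.
  - intros a x. apply converges_to_unique with (1 := HT (vscal a x)).
    intros eps Heps. destruct (converges_to_scal a _ _ (HT x) eps Heps) as [N HN].
    exists N. intros p Hp. rewrite S_scal. now apply HN.
  - exists B. intros x. apply converges_to_vnorm_le with (1 := HT x). intros m. apply S_bound.
Qed.

(** Split S_p u_p - T l as S_p (u_p - l) + (S_p l - T l); the uniform bound controls the first term.
    This serves both the powers of the limit operator and its eigenvectors. *)
Lemma strong_limit_diagonal (T : X -> X) (u : nat -> X) (l : X) :
  (forall x, converges_to (fun m => S m x) (T x)) -> converges_to u l ->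
  converges_to (fun m => S m (u m)) (T l).
Proof.
  intros HT Hu eps Heps.
  destruct (HT l (eps / 2)) as [N HN]; [lra|].
  assert (HB := Rabs_pos B).
  (* [Rabs B + 1] is a positive constant above [B], whatever the sign of [B]. *)
  destruct (Hu (eps / 2 / (Rabs B + 1))) as [N' HN']; [apply Rdiv_lt_0_compat; lra|].
  exists (max N N'). intros p Hp. specialize (HN p ltac:(lia)). specialize (HN' p ltac:(lia)).
  assert (Ht := vnorm_vsub_triangle (S p (u p)) (S p l) (T l)).
  rewrite <- linear_vsub in Ht; auto. assert (Hb := S_bound p (vsub (u p) l)).
  apply (Rmult_lt_compat_l (Rabs B + 1)) in HN'; [|lra].
  replace ((Rabs B + 1) * (eps / 2 / (Rabs B + 1))) with (eps / 2) in HN' by (field; lra).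
  assert (H0 := vnorm_nonneg X (vsub (u p) l)). assert (H1 := Rle_abs B). nra.
Qed.

Lemma strong_limit_iter (T : X -> X) (n : nat) (x : X) :
  (forall x, converges_to (fun m => S m x) (T x)) ->
  converges_to (fun m => Nat.iter n (S m) x) (Nat.iter n T x).
Proof.
  intros HT. induction n as [|n IH].
  - intros eps Heps. exists 0%nat. intros p _. simpl. now rewrite vsub_cancel, vnorm_zero.
  - apply (strong_limit_diagonal T _ _ HT IH).
Qed.

End NormedSpace.

(** * The complex plane *)

Definition Cdist (a b : C) : R := Cmod (Cadd a (Copp b)).

(** Complex numbers here are pairs of reals with the same formulas as in Coquelicot, whose lemmas
    therefore apply by conversion. *)
Lemma Cmod_mul (a b : C) : Cmod (Cmul a b) = Cmod a * Cmod b.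
Proof. exact (Complex.Cmod_mult a b). Qed.

Lemma Cmod_C1 : Cmod C1 = 1.
Proof. exact Complex.Cmod_1. Qed.

Lemma Cmod_C0 : Cmod C0 = 0.
Proof. exact Complex.Cmod_0. Qed.

Lemma Cmod_RtoC (r : R) : 0 <= r -> Cmod (r, 0) = r.
Proof.
  intros Hr. transitivity (sqrt (r ^ 2)); [|now apply sqrt_pow2].
  unfold Cmod. f_equal. simpl. ring.
Qed.

Lemma Cdist_sym (a b : C) : Cdist a b = Cdist b a.
Proof. unfold Cdist, Cmod. f_equal. simpl. ring. Qed.

Lemma Cdist_triangle (a b c : C) : Cdist a c <= Cdist a b + Cdist b c.
Proof.
  unfold Cdist.
  replace (Cadd a (Copp c)) with (Cadd (Cadd a (Copp b)) (Cadd b (Copp c)))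
    by (apply injective_projections; simpl; ring).
  apply Complex.Cmod_triangle.
Qed.

Lemma Cdist_same (a : C) : Cdist a a = 0.
Proof.
  unfold Cdist. rewrite <- Cmod_C0. f_equal. apply injective_projections; simpl; ring.
Qed.

Lemma Cdist_eq0 (a b : C) : Cdist a b = 0 -> a = b.
Proof.
  intros H. assert (Hz : Cadd a (Copp b) = C0).
  { apply Csq_eq0. rewrite <- Cmod_sq. unfold Cdist in H. rewrite H. ring. }
  apply (f_equal fst) in Hz as H1. apply (f_equal snd) in Hz as H2. simpl in H1, H2.
  apply injective_projections; lra.
Qed.

Lemma Cdist_gt0 (a b : C) : a <> b -> 0 < Cdist a b.
Proof.
  intros Hab. destruct (Rle_lt_or_eq_dec 0 (Cdist a b)); [apply Cmod_ge0|trivial|].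
  now destruct Hab; apply Cdist_eq0.
Qed.

Lemma Cdist_mul_l (a b c : C) : Cdist (Cmul a b) (Cmul a c) = Cmod a * Cdist b c.
Proof.
  unfold Cdist. rewrite <- Cmod_mul. f_equal. apply injective_projections; simpl; ring.
Qed.

Lemma Cdist_Cmod (a b : C) : Rabs (Cmod a - Cmod b) <= Cdist a b.
Proof.
  assert (H : forall z, Cmod z = Cdist z C0).
  { intros z. unfold Cdist. f_equal. apply injective_projections; simpl; ring. }
  rewrite 2!H. assert (H1 := Cdist_triangle a b C0). assert (H2 := Cdist_triangle b a C0).
  rewrite (Cdist_sym b a) in H2. apply Rabs_le. lra.
Qed.

Fixpoint Cpow (z : C) (n : nat) : C :=
  match n with O => C1 | S n => Cmul z (Cpow z n) end.

Lemma Cmod_pow (z : C) (n : nat) : Cmod z = 1 -> Cmod (Cpow z n) = 1.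
Proof.
  intros Hz. induction n as [|n IH]; simpl; [apply Cmod_C1|]. rewrite Cmod_mul, Hz, IH. ring.
Qed.

Lemma Cpow_mul (a b : C) (n : nat) : Cpow (Cmul a b) n = Cmul (Cpow a n) (Cpow b n).
Proof.
  induction n as [|n IH]; simpl; [|rewrite IH]; apply injective_projections; simpl; ring.
Qed.

Lemma Cmul_conj_unimodular (z : C) : Cmod z = 1 -> Cmul z (Cconj z) = C1.
Proof.
  intros Hz. assert (H := Cmod_sq z). rewrite Hz in H. unfold Csq in H.
  apply injective_projections; simpl; [|ring]. simpl in H. lra.
Qed.

(** For unimodular b, the number a conj(b) is the ratio a / b, and multiplication by b^n preserves
    distances. *)
Lemma Cdist_Cpow_ratio (a b : C) (n : nat) :
  Cmod b = 1 -> Cdist (Cpow (Cmul a (Cconj b)) n) C1 = Cdist (Cpow a n) (Cpow b n).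
Proof.
  intros Hb.
  rewrite <- (Rmult_1_l (Cdist _ C1)), <- (Cmod_pow b n Hb), <- Cdist_mul_l, <- Cpow_mul.
  f_equal.
  - f_equal.
    replace (Cmul b (Cmul a (Cconj b))) with (Cmul a (Cmul b (Cconj b)))
      by (apply injective_projections; simpl; ring).
    rewrite (Cmul_conj_unimodular b Hb). apply injective_projections; simpl; ring.
  - apply injective_projections; simpl; ring.
Qed.

(** * The gap condition and the Jamison property *)

(* The exponent 1 is included besides the n k: a bounded operator is bounded at
   exponent 1 as well, and n 0 need not be 1. *)
Definition uniform_gap (n : nat -> nat) : Prop :=
  exists eps, 0 < eps /\ forall z, Cmod z = 1 -> z <> C1 ->
    eps <= Cdist z C1 \/ exists k, eps <= Cdist (Cpow z (n k)) C1.

Lemma iter_eigenvector (X : CNormedSpace) (T : X -> X) (lam : C) (x : X) (N : nat) :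
  homogeneous X T -> T x = vscal lam x -> Nat.iter N T x = vscal (Cpow lam N) x.
Proof.
  intros HT Hx. induction N as [|N IH]; simpl.
  - now rewrite vscal_one.
  - rewrite IH, HT, Hx, vscal_assoc. f_equal. apply injective_projections; simpl; ring.
Qed.

Lemma iter_vsub (X : CNormedSpace) (T : X -> X) (x y : X) (N : nat) :
  additive X T -> homogeneous X T ->
  Nat.iter N T (vsub x y) = vsub (Nat.iter N T x) (Nat.iter N T y).
Proof.
  intros Ha Hh. induction N as [|N IH]; simpl; [reflexivity|]. now rewrite IH, linear_vsub.
Qed.

(** Write (lam^N - mu^N) x = T^N (x - y) + mu^N (y - x) and take norms. *)
Lemma eigenvalue_dist_le (X : CNormedSpace) (T : X -> X) (lam mu : C) (x y : X) (N : nat) (M : R) :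
  additive X T -> homogeneous X T -> T x = vscal lam x -> T y = vscal mu y ->
  vnorm x = 1 -> Cmod mu = 1 ->
  vnorm (Nat.iter N T (vsub x y)) <= M * vnorm (vsub x y) ->
  Cdist (Cpow lam N) (Cpow mu N) <= (M + 1) * vnorm (vsub x y).
Proof.
  intros Ha Hh Hx Hy Hn Hm HM. rewrite iter_vsub in HM by assumption.
  rewrite (iter_eigenvector X T lam x N Hh Hx), (iter_eigenvector X T mu y N Hh Hy) in HM.
  assert (H : vnorm (vsub (vscal (Cpow lam N) x) (vscal (Cpow mu N) x)) = Cdist (Cpow lam N) (Cpow mu N)).
  { rewrite vsub_scal_l, vnorm_scal, Hn. unfold Cdist. ring. }
  rewrite <- H.
  apply Rle_trans with (1 := vnorm_vsub_triangle X _ (vscal (Cpow mu N) y) _).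
  rewrite vsub_scal, vnorm_scal, (Cmod_pow mu N Hm), (vnorm_vsub_sym X y x). lra.
Qed.

Lemma unit_eigenvector (X : CNormedSpace) (T : X -> X) (lam : C) :
  homogeneous X T -> eigenvalue T lam -> exists x : X, vnorm x = 1 /\ T x = vscal lam x.
Proof.
  intros Hh (x & Hx & HT).
  assert (Hn : 0 < vnorm x).
  { destruct (Rle_lt_or_eq_dec 0 _ (vnorm_nonneg X x)) as [H|H]; [exact H|].
    destruct Hx. apply vnorm_eq0. now symmetry. }
  exists (vscal (/ vnorm x, 0) x). split.
  - rewrite vnorm_scal, Cmod_RtoC by (left; now apply Rinv_0_lt_compat). field. lra.
  - rewrite Hh, HT, 2!vscal_assoc. f_equal. apply injective_projections; simpl; ring.
Qed.

(** Unit eigenvectors for distinct unimodular eigenvalues stay uniformly apart. Hence a ball of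
    radius [eta] around a point of the dense sequence meets the unit eigenvectors of at most one
    such eigenvalue, and the dense sequence enumerates them. *)
Lemma uniform_gap_Jamison (n : nat -> nat) : uniform_gap n -> Jamison_sequence n.
Proof.
  intros (eps & Heps & Hgap) X T (Ha & Hh & M1 & HM1) (M2 & HM2).
  destruct (sb_separable X) as [d Hd].
  set (M := Rabs M1 + Rabs M2).
  assert (HM : 0 <= M) by (assert (H1 := Rabs_pos M1); assert (H2 := Rabs_pos M2); unfold M; lra).
  (* Chosen so that (M + 1) (2 eta) = eps / 2 < eps. *)
  set (eta := eps / (4 * (M + 1))).
  assert (Heta : 0 < eta) by (apply Rdiv_lt_0_compat; lra).
  set (P := fun k lam => Cmod lam = 1 /\
    exists x : X, vnorm x = 1 /\ T x = vscal lam x /\ vnorm (vsub x (d k)) < eta).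
  assert (HP : forall k lam mu, P k lam -> P k mu -> lam = mu).
  { intros k lam mu (Hl & x & Hx1 & Hx & Hxd) (Hm & y & Hy1 & Hy & Hyd).
    apply NNPP. intros Hne.
    assert (Hxy : vnorm (vsub x y) < 2 * eta).
    { assert (H := vnorm_vsub_triangle X x (d k) y).
      rewrite (vnorm_vsub_sym X (d k) y) in H. lra. }
    assert (H0 := vnorm_nonneg X (vsub x y)).
    assert (Hpow : forall N, vnorm (Nat.iter N T (vsub x y)) <= M * vnorm (vsub x y) ->
              Cdist (Cpow (Cmul lam (Cconj mu)) N) C1 < eps).
    { intros N HN. rewrite (Cdist_Cpow_ratio lam mu N Hm).
      apply Rle_lt_trans with ((M + 1) * vnorm (vsub x y)).
      - now apply (eigenvalue_dist_le X T lam mu x y N M).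
      - apply Rlt_trans with ((M + 1) * (2 * eta)); [apply Rmult_lt_compat_l; lra|].
        unfold eta. replace ((M + 1) * (2 * (eps / (4 * (M + 1))))) with (eps / 2) by (field; lra).
        lra. }
    assert (Hle1 := Rle_abs M1). assert (Hle2 := Rle_abs M2).
    assert (Hp1 := Rabs_pos M1). assert (Hp2 := Rabs_pos M2).
    (* The gap is applied to the ratio of the two eigenvalues, which is unimodular and different
       from 1. *)
    destruct (Hgap (Cmul lam (Cconj mu))) as [H|[k' H]].
    - rewrite Cmod_mul, Hl. replace (Cmod (Cconj mu)) with (Cmod mu); [lra|].
      unfold Cmod. f_equal. simpl. ring.
    - intros H. apply Hne.
      transitivity (Cmul (Cmul lam (Cconj mu)) mu).
      + replace (Cmul (Cmul lam (Cconj mu)) mu) with (Cmul lam (Cmul mu (Cconj mu)))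
          by (apply injective_projections; simpl; ring).
        rewrite (Cmul_conj_unimodular mu Hm). apply injective_projections; simpl; ring.
      + rewrite H. apply injective_projections; simpl; ring.
    - assert (H' : Cdist (Cpow (Cmul lam (Cconj mu)) 1) C1 < eps).
      { apply Hpow. simpl. assert (HT := HM1 (vsub x y)). unfold M. nra. }
      replace (Cpow (Cmul lam (Cconj mu)) 1) with (Cmul lam (Cconj mu)) in H'
        by (apply injective_projections; simpl; ring).
      lra.
    - assert (H' : Cdist (Cpow (Cmul lam (Cconj mu)) (n k')) C1 < eps); [|lra].
      apply Hpow. assert (HT := HM2 k' (vsub x y)). unfold M. nra. }
  (* Where no eigenvalue is attached to [d k], the value is arbitrary. *)
  exists (fun k => epsilon (inhabits C0) (P k)).
  intros lam Hlam He.
  destruct (unit_eigenvector X T lam Hh He) as (x & Hx1 & Hx).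
  destruct (Hd x eta Heta) as [k Hk]. exists k.
  assert (Hk' : P k lam) by (split; [exact Hlam|exists x; auto]).
  apply (HP k); [|exact Hk']. apply epsilon_spec. now exists lam.
Qed.

(** * The bit operators *)

Lemma sqsum_pull (p : nat -> option nat) (x : nat -> C) :
  pinj p -> sqsum x -> sqsum (pull C0 p x).
Proof.
  intros Hp Hx.
  destruct (Series_pull p (fun i => Csq (x i)) Hp) as [H _]; [intros; apply Csq_ge0|exact Hx|].
  revert H. apply ex_series_ext. intros a. unfold pull. destruct (p a); [reflexivity|].
  unfold Csq; simpl; ring.
Qed.

Definition l2_pull (p : nat -> option nat) (Hp : pinj p) (x : l2) : l2 :=
  exist _ _ (sqsum_pull p _ Hp (proj2_sig x)).

Lemma l2_norm_pull (p : nat -> option nat) (Hp : pinj p) (x : l2) :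
  l2_norm (l2_pull p Hp x) <= l2_norm x.
Proof.
  apply sqrt_le_1_alt. unfold l2_sq.
  rewrite (Series_ext _ (pull 0 p (fun i => Csq (coef x i)))).
  - apply Series_pull; [exact Hp|intros; apply Csq_ge0|apply (proj2_sig x)].
  - intros a. unfold coef, l2_pull, pull; simpl. destruct (p a); [reflexivity|].
    unfold Csq; simpl; ring.
Qed.

Lemma testbit_setbit_same (a j : nat) : Nat.testbit (Nat.setbit a j) j = true.
Proof. apply Nat.setbit_eq. Qed.

Lemma testbit_setbit_other (a i j : nat) :
  i <> j -> Nat.testbit (Nat.setbit a j) i = Nat.testbit a i.
Proof. intros H. apply Nat.setbit_neq. auto. Qed.

Lemma testbit_clearbit_other (a i j : nat) :
  i <> j -> Nat.testbit (Nat.clearbit a j) i = Nat.testbit a i.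
Proof. intros H. apply Nat.clearbit_neq. auto. Qed.

Ltac bitwise j :=
  let b := fresh "b" in
  apply Nat.bits_inj; intros b;
  rewrite ?Nat.setbit_eqb, ?Nat.clearbit_eqb, ?Nat.setbit_eqb, ?Nat.clearbit_eqb;
  destruct (Nat.eqb_spec j b) as [<-|]; simpl; rewrite ?Bool.andb_true_r; auto.

Lemma setbit_clearbit (a j : nat) :
  Nat.testbit a j = true -> Nat.setbit (Nat.clearbit a j) j = a.
Proof. intros H. bitwise j. Qed.

Lemma clearbit_setbit (a j : nat) :
  Nat.testbit a j = false -> Nat.clearbit (Nat.setbit a j) j = a.
Proof. intros H. bitwise j. Qed.

Lemma setbit_comm (a i j : nat) : Nat.setbit (Nat.setbit a i) j = Nat.setbit (Nat.setbit a j) i.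
Proof.
  apply Nat.bits_inj; intros b. rewrite !Nat.setbit_eqb.
  destruct (Nat.eqb i b), (Nat.eqb j b); reflexivity.
Qed.

Lemma clearbit_setbit_comm (a i j : nat) :
  i <> j -> Nat.clearbit (Nat.setbit a i) j = Nat.setbit (Nat.clearbit a j) i.
Proof.
  intros Hij. apply Nat.bits_inj; intros b.
  rewrite Nat.clearbit_eqb, !Nat.setbit_eqb, Nat.clearbit_eqb.
  destruct (Nat.eqb_spec i b), (Nat.eqb_spec j b), (Nat.testbit a b); subst; try reflexivity.
  all: contradiction.
Qed.

(** Bit j of an index selects e_0 or e_1 in factor j. Pulling back along these three maps gives, on
    that factor, the projection onto e_1 and the matrix units e_1 -> e_0 and e_0 -> e_1. *)
Definition bit_keep (j a : nat) : option nat := if Nat.testbit a j then Some a else None.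
Definition bit_lower (j a : nat) : option nat :=
  if Nat.testbit a j then None else Some (Nat.setbit a j).
Definition bit_raise (j a : nat) : option nat :=
  if Nat.testbit a j then Some (Nat.clearbit a j) else None.

Lemma pinj_bit_keep (j : nat) : pinj (bit_keep j).
Proof.
  intros a a' b. unfold bit_keep.
  destruct (Nat.testbit a j), (Nat.testbit a' j); congruence.
Qed.

Lemma pinj_bit_lower (j : nat) : pinj (bit_lower j).
Proof.
  intros a a' b. unfold bit_lower.
  destruct (Nat.testbit a j) eqn:E, (Nat.testbit a' j) eqn:E'; try discriminate.
  intros [= <-] [= H]. rewrite <- (clearbit_setbit a j E), <- H. now apply clearbit_setbit.
Qed.

Lemma pinj_bit_raise (j : nat) : pinj (bit_raise j).
Proof.
  intros a a' b. unfold bit_raise.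
  destruct (Nat.testbit a j) eqn:E, (Nat.testbit a' j) eqn:E'; try discriminate.
  intros [= <-] [= H]. rewrite <- (setbit_clearbit a j E), <- H. now apply setbit_clearbit.
Qed.

(** The operator t_j(c) on factor j, as the identity plus (c - 1) Q, where Q sends e_0 to 0 and e_1
    to e_1 + 2^j e_0. *)
Definition twist (j : nat) (c : C) (x : l2) : l2 :=
  l2_add x (l2_scal (Cadd c (Copp C1))
    (l2_add (l2_pull _ (pinj_bit_keep j) x)
            (l2_scal (2 ^ j, 0) (l2_pull _ (pinj_bit_lower j) x)))).

(** On factor j this sends e_0 to e_0 + a e_1 and fixes e_1; it builds the eigenvectors one factor
    at a time. *)
Definition raise (j : nat) (a : C) (x : l2) : l2 :=
  l2_add x (l2_scal a (l2_pull _ (pinj_bit_raise j) x)).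

Lemma coef_twist (j : nat) (c : C) (x : l2) (a : nat) :
  coef (twist j c x) a =
    if Nat.testbit a j then Cmul c (coef x a)
    else Cadd (coef x a) (Cmul (Cmul (2 ^ j, 0) (Cadd c (Copp C1))) (coef x (Nat.setbit a j))).
Proof.
  unfold twist, coef, l2_add, l2_scal, l2_pull, pull, bit_keep, bit_lower; cbn [proj1_sig].
  destruct (Nat.testbit a j); apply injective_projections; simpl; ring.
Qed.

Lemma coef_raise (j : nat) (c : C) (x : l2) (a : nat) :
  coef (raise j c x) a =
    if Nat.testbit a j then Cadd (coef x a) (Cmul c (coef x (Nat.clearbit a j))) else coef x a.
Proof.
  unfold raise, coef, l2_add, l2_scal, l2_pull, pull, bit_raise; cbn [proj1_sig].
  destruct (Nat.testbit a j); apply injective_projections; simpl; ring.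
Qed.

Lemma twist_add (j : nat) (c : C) : additive l2_space (twist j c).
Proof.
  intros x y. apply l2_ext. intros a. change vadd with l2_add.
  change (coef (l2_add (twist j c x) (twist j c y)) a)
    with (Cadd (coef (twist j c x) a) (coef (twist j c y) a)).
  rewrite !coef_twist. unfold coef, l2_add; cbn [proj1_sig].
  destruct (Nat.testbit a j); apply injective_projections; simpl; ring.
Qed.

Lemma twist_scal (j : nat) (c : C) : homogeneous l2_space (twist j c).
Proof.
  intros b x. apply l2_ext. intros a. change vscal with l2_scal.
  change (coef (l2_scal b (twist j c x)) a) with (Cmul b (coef (twist j c x) a)).
  rewrite !coef_twist. unfold coef, l2_scal; cbn [proj1_sig].
  destruct (Nat.testbit a j); apply injective_projections; simpl; ring.
Qed.

(** Q is idempotent, so 1 + (c - 1) Q is multiplicative in c. *)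
Lemma twist_twist (j : nat) (c c' : C) (x : l2) :
  twist j c (twist j c' x) = twist j (Cmul c c') x.
Proof.
  apply l2_ext. intros a. rewrite !coef_twist, testbit_setbit_same.
  destruct (Nat.testbit a j); apply injective_projections; simpl; ring.
Qed.

Lemma twist_comm (i j : nat) (c c' : C) (x : l2) :
  i <> j -> twist i c (twist j c' x) = twist j c' (twist i c x).
Proof.
  intros Hij. apply l2_ext. intros a.
  rewrite !coef_twist, testbit_setbit_other, (testbit_setbit_other a i j), (setbit_comm a i j) by auto.
  destruct (Nat.testbit a i), (Nat.testbit a j); apply injective_projections; simpl; ring.
Qed.

Lemma twist_raise_comm (i j : nat) (c b : C) (x : l2) :
  i <> j -> twist i c (raise j b x) = raise j b (twist i c x).
Proof.
  intros Hij. apply l2_ext. intros a.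
  rewrite coef_raise, !coef_twist, !coef_raise, testbit_setbit_other, testbit_clearbit_other,
    (clearbit_setbit_comm a i j) by auto.
  destruct (Nat.testbit a i), (Nat.testbit a j); apply injective_projections; simpl; ring.
Qed.

(** The hypothesis says that factor j of [x] is e_0. Raising turns it into e_0 + 2^-j e_1, the
    eigenvector of t_j(c) for c. *)
Lemma twist_raise_true (j : nat) (c : C) (x : l2) :
  (forall a, Nat.testbit a j = true -> coef x a = C0) ->
  twist j c (raise j ((/ 2) ^ j, 0) x) = l2_scal c (raise j ((/ 2) ^ j, 0) x).
Proof.
  intros Hx. apply l2_ext. intros a.
  change (coef (l2_scal c ?y) a) with (Cmul c (coef y a)).
  rewrite coef_twist, !coef_raise, testbit_setbit_same.
  destruct (Nat.testbit a j) eqn:E; [reflexivity|].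
  rewrite (clearbit_setbit a j E), (Hx (Nat.setbit a j)) by apply testbit_setbit_same.
  assert (H : 2 ^ j * (/ 2) ^ j = 1).
  { rewrite <- Rpow_mult_distr. replace (2 * / 2) with 1 by field. apply pow1. }
  destruct c as [c d], (coef x a) as [p q].
  (* With the powers abstracted, both coordinates become polynomial identities modulo u v = 1. *)
  set (u := 2 ^ j) in *. set (v := (/ 2) ^ j) in *.
  apply injective_projections; simpl.
  - transitivity (p + (u * v) * ((c - 1) * p - d * q)); [ring|rewrite H; ring].
  - transitivity (q + (u * v) * ((c - 1) * q + d * p)); [ring|rewrite H; ring].
Qed.

Lemma twist_raise_false (j : nat) (c : C) (x : l2) :
  (forall a, Nat.testbit a j = true -> coef x a = C0) ->
  twist j c (raise j C0 x) = raise j C0 x.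
Proof.
  intros Hx. apply l2_ext. intros a.
  rewrite coef_twist, !coef_raise, testbit_setbit_same.
  rewrite (Hx (Nat.setbit a j)) by apply testbit_setbit_same.
  destruct (Nat.testbit a j) eqn:E; [rewrite (Hx a E)|];
  apply injective_projections; simpl; ring.
Qed.

(** The operator multiplied by c - 1 has norm at most 2 * 2^j, and the factor 4^-j turns this into 2
    * 2^-j. *)
Lemma twist_near_id (j : nat) (c : C) (x : l2_space) :
  Cdist c C1 <= (/ 4) ^ j ->
  vnorm (vsub (twist j c x : l2_space) x) <= 2 * (/ 2) ^ j * vnorm x.
Proof.
  intros Hc.
  set (y := l2_add (l2_pull _ (pinj_bit_keep j) x)
                   (l2_scal (2 ^ j, 0) (l2_pull _ (pinj_bit_lower j) x))).
  replace (vsub (twist j c x : l2_space) x) with (l2_scal (Cadd c (Copp C1)) y : l2_space).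
  2:{ apply l2_ext. intros a. unfold twist. fold y. unfold coef; simpl.
      apply injective_projections; simpl; ring. }
  rewrite vnorm_scal. fold (Cdist c C1).
  assert (H1 : (1 : R) <= 2 ^ j) by (apply pow_R1_Rle; lra).
  assert (H0 := vnorm_nonneg l2_space x).
  assert (Hy : vnorm (y : l2_space) <= 2 * 2 ^ j * vnorm x).
  { apply Rle_trans with (1 := l2_norm_triangle _ _).
    rewrite l2_norm_scal, Cmod_RtoC by lra.
    assert (Ha := l2_norm_pull _ (pinj_bit_keep j) x).
    assert (Hb := l2_norm_pull _ (pinj_bit_lower j) x).
    change (vnorm x) with (l2_norm x) in *. nra. }
  apply Rle_trans with ((/ 4) ^ j * (2 * 2 ^ j * vnorm x)).
  - apply Rmult_le_compat; trivial; [apply Cmod_ge0|apply vnorm_nonneg].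
  - right. replace (/ 4) with (/ 2 * / 2) by field. rewrite Rpow_mult_distr.
    transitivity (2 * (/ 2) ^ j * vnorm x * ((/ 2) ^ j * 2 ^ j)); [ring|].
    rewrite <- Rpow_mult_distr. replace (/ 2 * 2) with 1 by field. rewrite pow1. ring.
Qed.

(** The constant 2 gives the bound the same form as for the twists, so that one increment lemma
    covers both. *)
Lemma raise_near_id (j : nat) (b : bool) (x : l2_space) :
  vnorm (vsub (raise j (if b then ((/ 2) ^ j, 0) else C0) x : l2_space) x)
    <= 2 * (/ 2) ^ j * vnorm x.
Proof.
  set (c := if b then _ else _).
  replace (vsub (raise j c x : l2_space) x)
    with (l2_scal c (l2_pull _ (pinj_bit_raise j) x) : l2_space).
  2:{ apply l2_ext. intros a. unfold raise. unfold coef; simpl.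
      apply injective_projections; simpl; ring. }
  assert (Hj : 0 < (/ 2) ^ j) by (apply pow_lt; lra).
  assert (Hc : Cmod c <= (/ 2) ^ j).
  { unfold c. destruct b; [rewrite Cmod_RtoC|rewrite Cmod_C0]; lra. }
  rewrite vnorm_scal. assert (Hr := l2_norm_pull _ (pinj_bit_raise j) x).
  assert (H0 := vnorm_nonneg l2_space x). assert (H1 := Cmod_ge0 c).
  change (vnorm (l2_pull _ (pinj_bit_raise j) x : l2_space))
    with (l2_norm (l2_pull _ (pinj_bit_raise j) x)).
  change (vnorm x) with (l2_norm x) in *.
  apply Rle_trans with ((/ 2) ^ j * l2_norm x); [|nra].
  apply Rmult_le_compat; trivial. apply sqrt_pos.
Qed.

(** * Sequences with summable relative increments, and finite products of twists *)

Lemma multiplicative_increment_bound (X : CNormedSpace) (u : nat -> X) (m : nat) :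
  (forall m, vnorm (vsub (u (S m)) (u m)) <= 2 * (/ 2) ^ m * vnorm (u m)) ->
  vnorm (u m) <= exp 4 * vnorm (u 0%nat).
Proof.
  intros Hu. assert (H0 := vnorm_nonneg X (u 0%nat)).
  (* Each step costs a factor 1 + 2 * 2^-i <= exp (2 * 2^-i); the exponents for i < m add up to 4 (1
     - 2^-m). *)
  assert (H : vnorm (u m) <= exp (4 * (1 - (/ 2) ^ m)) * vnorm (u 0%nat)).
  { induction m as [|m IH].
    - simpl. replace (4 * (1 - 1)) with 0 by ring. rewrite exp_0. lra.
    - assert (Ht := vnorm_vsub_le X (u (S m)) (u m)). specialize (Hu m).
      assert (Hm : 0 < (/ 2) ^ m) by (apply pow_lt; lra).
      assert (He : 1 + 2 * (/ 2) ^ m <= exp (2 * (/ 2) ^ m)).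
      { left. apply exp_ineq1. lra. }
      replace (4 * (1 - (/ 2) ^ S m)) with (2 * (/ 2) ^ m + 4 * (1 - (/ 2) ^ m))
        by (simpl; field).
      rewrite exp_plus, Rmult_assoc.
      apply Rle_trans with ((1 + 2 * (/ 2) ^ m) * vnorm (u m)); [lra|].
      apply Rmult_le_compat; trivial; [lra|apply vnorm_nonneg]. }
  apply Rle_trans with (1 := H). apply Rmult_le_compat_r; trivial.
  assert (Hm : 0 < (/ 2) ^ m) by (apply pow_lt; lra).
  left. apply exp_increasing. lra.
Qed.

Lemma multiplicative_increment_cauchy (X : CNormedSpace) (u : nat -> X) :
  (forall m, vnorm (vsub (u (S m)) (u m)) <= 2 * (/ 2) ^ m * vnorm (u m)) -> cauchy_seq u.
Proof.
  intros Hu. assert (H0 := vnorm_nonneg X (u 0%nat)).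
  assert (He := exp_pos 4).
  apply (geometric_cauchy X u (2 * (exp 4 * vnorm (u 0%nat)))); [nra|].
  intros m. apply Rle_trans with (1 := Hu m).
  assert (Hb := multiplicative_increment_bound X u m Hu).
  assert (Hm : 0 < (/ 2) ^ m) by (apply pow_lt; lra). nra.
Qed.

Fixpoint twists (c : nat -> C) (m : nat) (x : l2) : l2 :=
  match m with O => x | S m => twist m (c m) (twists c m x) end.

Lemma twists_add (c : nat -> C) (m : nat) : additive l2_space (twists c m).
Proof.
  induction m as [|m IH]; intros x y; simpl twists; [reflexivity|]. rewrite IH. apply twist_add.
Qed.

Lemma twists_scal (c : nat -> C) (m : nat) : homogeneous l2_space (twists c m).
Proof.
  induction m as [|m IH]; intros a x; simpl twists; [reflexivity|]. rewrite IH. apply twist_scal.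
Qed.

Lemma twist_twists_comm (i m : nat) (b : C) (c : nat -> C) (x : l2) :
  (m <= i)%nat -> twist i b (twists c m x) = twists c m (twist i b x).
Proof.
  induction m as [|m IH]; intros Hm; simpl; [reflexivity|].
  rewrite twist_comm by lia. now rewrite IH by lia.
Qed.

Lemma twists_raise_comm (i m : nat) (b : C) (c : nat -> C) (x : l2) :
  (m <= i)%nat -> twists c m (raise i b x) = raise i b (twists c m x).
Proof.
  induction m as [|m IH]; intros Hm; simpl; [reflexivity|].
  rewrite IH by lia. apply twist_raise_comm. lia.
Qed.

(** Twists on different bits commute, so the two products regroup bit by bit. *)
Lemma twists_twists (c c' : nat -> C) (m : nat) (x : l2) :
  twists c m (twists c' m x) = twists (fun j => Cmul (c j) (c' j)) m x.
Proof.
  induction m as [|m IH]; simpl; [reflexivity|].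
  rewrite <- twist_twists_comm, IH, twist_twist by lia. reflexivity.
Qed.

Lemma twists_1 (m : nat) (x : l2) : twists (fun _ => C1) m x = x.
Proof.
  induction m as [|m IH]; simpl; [reflexivity|]. rewrite IH. apply l2_ext. intros a.
  rewrite coef_twist. destruct (Nat.testbit a m); apply injective_projections; simpl; ring.
Qed.

(** Powers have the same form with c_j^N in place of c_j. Bounding them thus only requires c_j^N to
    be close to 1. *)
Lemma iter_twists (c : nat -> C) (m N : nat) (x : l2) :
  Nat.iter N (twists c m) x = twists (fun j => Cpow (c j) N) m x.
Proof.
  induction N as [|N IH]; simpl Nat.iter; [symmetry; apply twists_1|].
  rewrite IH, twists_twists. reflexivity.
Qed.

Lemma twists_increment (c : nat -> C) (m : nat) (x : l2_space) :
  (forall j, Cdist (c j) C1 <= (/ 4) ^ j) ->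
  vnorm (vsub (twists c (S m) x : l2_space) (twists c m x))
    <= 2 * (/ 2) ^ m * vnorm (twists c m x : l2_space).
Proof. intros Hc. apply twist_near_id, Hc. Qed.

Lemma twists_bound (c : nat -> C) (m : nat) (x : l2_space) :
  (forall j, Cdist (c j) C1 <= (/ 4) ^ j) ->
  vnorm (twists c m x : l2_space) <= exp 4 * vnorm x.
Proof.
  intros Hc. apply (multiplicative_increment_bound l2_space (fun m => twists c m x)).
  intros k. now apply twists_increment.
Qed.

Lemma twists_cauchy (c : nat -> C) (x : l2_space) :
  (forall j, Cdist (c j) C1 <= (/ 4) ^ j) ->
  cauchy_seq (fun m => twists c m x : l2_space).
Proof.
  intros Hc. apply multiplicative_increment_cauchy. intros k. now apply twists_increment.
Qed.

(** * Eigenvectors and eigenvalues *)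

(** The vector with factors e_0 + s_j 2^-j e_1 for j < m and e_0 beyond; [delta 0] has every factor
    e_0, as all bits of 0 vanish. *)
Fixpoint eigvec (s : nat -> bool) (m : nat) : l2 :=
  match m with
  | O => delta 0
  | S m => raise m (if s m then ((/ 2) ^ m, 0) else C0) (eigvec s m)
  end.

Fixpoint eigval (c : nat -> C) (s : nat -> bool) (m : nat) : C :=
  match m with
  | O => C1
  | S m => if s m then Cmul (c m) (eigval c s m) else eigval c s m
  end.

(** This coordinate lets the eigenvalue be read off and shows that the limit vector is nonzero. *)
Lemma coef_eigvec_0 (s : nat -> bool) (m : nat) : coef (eigvec s m) 0 = C1.
Proof. induction m as [|m IH]; simpl eigvec; [reflexivity|]. now rewrite coef_raise, Nat.bits_0. Qed.

Lemma coef_eigvec_high (s : nat -> bool) (m j a : nat) :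
  (m <= j)%nat -> Nat.testbit a j = true -> coef (eigvec s m) a = C0.
Proof.
  revert a. induction m as [|m IH]; intros a Hm Ha; simpl eigvec.
  - change (coef (delta 0) a) with (delta_fun 0 a). unfold delta_fun.
    destruct (Nat.eqb_spec a 0); [|reflexivity]. subst. now rewrite Nat.bits_0 in Ha.
  - rewrite coef_raise, IH, IH by (trivial; try rewrite testbit_clearbit_other; trivial; lia).
    destruct (Nat.testbit a m); [|reflexivity]. apply injective_projections; simpl; ring.
Qed.

Lemma raise_scal (j : nat) (b a : C) (x : l2) :
  raise j b (l2_scal a x) = l2_scal a (raise j b x).
Proof.
  apply l2_ext. intros i.
  change (coef (l2_scal a (raise j b x)) i) with (Cmul a (coef (raise j b x) i)).
  rewrite !coef_raise. unfold coef, l2_scal; cbn [proj1_sig].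
  destruct (Nat.testbit i j); apply injective_projections; simpl; ring.
Qed.

(** The last raise commutes with the earlier twists; the last twist then multiplies by [c m] or by 1
    according to [s m], since factor m was still e_0. *)
Lemma twists_eigvec (c : nat -> C) (s : nat -> bool) (m : nat) :
  twists c m (eigvec s m) = l2_scal (eigval c s m) (eigvec s m).
Proof.
  induction m as [|m IH]; simpl.
  - symmetry. apply (vscal_one l2_space).
  - assert (Hh : forall a, Nat.testbit a m = true -> coef (eigvec s m) a = C0).
    { intros a. now apply coef_eigvec_high. }
    rewrite twists_raise_comm, IH, raise_scal by lia.
    rewrite (twist_scal m (c m) (eigval c s m)). change vscal with l2_scal.
    destruct (s m).
    + rewrite twist_raise_true by exact Hh.
      etransitivity; [apply (vscal_assoc l2_space)|].
      change vscal with l2_scal. f_equal. apply injective_projections; simpl; ring.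
    + now rewrite twist_raise_false by exact Hh.
Qed.

(** * Convergence to eigenvectors of the limit operator *)

Lemma eigvec_cauchy (s : nat -> bool) : cauchy_seq (eigvec s : nat -> l2_space).
Proof. apply multiplicative_increment_cauchy. intros m. apply raise_near_id. Qed.

Definition Clim (u : nat -> C) (l : C) : Prop :=
  forall eps, 0 < eps -> exists N, forall m, (N <= m)%nat -> Cdist (u m) l < eps.

Lemma Clim_coef (u : nat -> l2_space) (l : l2_space) (i : nat) :
  converges_to u l -> Clim (fun m => coef (u m) i) (coef l i).
Proof.
  intros H eps Heps. destruct (H eps Heps) as [N HN]. exists N. intros m Hm.
  apply Rle_lt_trans with (2 := HN m Hm).
  apply (Cmod_coef_le (l2_add (u m) (l2_opp l))).
Qed.

Lemma Clim_unique (u : nat -> C) (l l' : C) : Clim u l -> Clim u l' -> l = l'.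
Proof.
  intros H H'. apply NNPP. intros Hne. apply Cdist_gt0 in Hne.
  destruct (H (Cdist l l' / 2)) as [N HN]; [lra|].
  destruct (H' (Cdist l l' / 2)) as [N' HN']; [lra|].
  specialize (HN (max N N') ltac:(lia)). specialize (HN' (max N N') ltac:(lia)).
  assert (Ht := Cdist_triangle l (u (max N N')) l').
  rewrite (Cdist_sym l (u _)) in Ht. lra.
Qed.

Lemma Clim_Cmod (u : nat -> C) (l : C) (r : R) :
  Clim u l -> (forall m, Cmod (u m) = r) -> Cmod l = r.
Proof.
  intros H Hr. apply cond_eq. intros eps Heps. destruct (H eps Heps) as [N HN].
  specialize (HN N (le_n N)). rewrite <- (Hr N), Rabs_minus_sym.
  apply Rle_lt_trans with (2 := HN). apply Cdist_Cmod.
Qed.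

(** Pass to the limit in [twists_eigvec]: the left side tends to T v, and its coordinate 0, which
    equals the finite eigenvalue, shows that the eigenvalues converge. *)
Lemma eigval_limit (c : nat -> C) (T : l2_space -> l2_space) (s : nat -> bool) :
  (forall j, Cdist (c j) C1 <= (/ 4) ^ j) ->
  (forall x, converges_to (fun m => twists c m x : l2_space) (T x)) ->
  exists lam, Clim (eigval c s) lam /\ eigenvalue T lam.
Proof.
  intros Hc HT. destruct (l2_complete _ (eigvec_cauchy s)) as [v Hv].
  assert (HS : converges_to (fun m => twists c m (eigvec s m) : l2_space) (T v)).
  { apply (strong_limit_diagonal l2_space (twists c) (exp 4)); trivial.
    - apply twists_add.
    - apply twists_scal.
    - intros m x. now apply twists_bound. }
  assert (Hlam : Clim (eigval c s) (coef (T v) 0)).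
  { intros eps Heps. destruct (Clim_coef _ _ 0 HS eps Heps) as [N HN]. exists N.
    intros m Hm. specialize (HN m Hm). cbv beta in HN. rewrite twists_eigvec in HN.
    replace (coef (l2_scal (eigval c s m) (eigvec s m)) 0) with (eigval c s m) in HN;
      [exact HN|].
    change (eigval c s m = Cmul (eigval c s m) (coef (eigvec s m) 0)).
    rewrite coef_eigvec_0. apply injective_projections; simpl; ring. }
  exists (coef (T v) 0). split; [exact Hlam|]. exists v. split.
  - intros H0.
    assert (H1 : Clim (fun m => coef (eigvec s m) 0) (coef v 0)) by now apply Clim_coef.
    assert (H2 : Clim (fun m => coef (eigvec s m) 0) C1).
    { intros eps Heps. exists 0%nat. intros m _. now rewrite coef_eigvec_0, Cdist_same. }
    assert (H := Clim_unique _ _ _ H1 H2). rewrite H0 in H.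
    apply (f_equal fst) in H. simpl in H. lra.
  (* The same sequence also tends to lam v: split the error into (eigval - lam) eigvec and lam
     (eigvec - v). *)
  - apply converges_to_unique with (1 := HS). intros eps Heps.
    set (lam := coef (T v) 0) in *. assert (Hv0 := vnorm_nonneg l2_space v).
    assert (Hl0 := Cmod_ge0 lam).
    (* Within distance 1 of v the approximants have norm below |v| + 2, so the first error is at
       most eps / 2. *)
    destruct (Hlam (eps / (2 * (vnorm v + 2)))) as [N HN]; [apply Rdiv_lt_0_compat; lra|].
    destruct (converges_to_scal l2_space lam _ _ Hv (eps / 2)) as [N' HN']; [lra|].
    destruct (Hv 1 Rlt_0_1) as [N'' HN''].
    exists (max N (max N' N'')). intros p Hp.
    specialize (HN p ltac:(lia)). specialize (HN' p ltac:(lia)). specialize (HN'' p ltac:(lia)).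
    rewrite twists_eigvec.
    assert (Ht := vnorm_vsub_triangle l2_space (vscal (eigval c s p) (eigvec s p : l2_space))
                    (vscal lam (eigvec s p : l2_space)) (vscal lam v)).
    rewrite vsub_scal_l, vnorm_scal in Ht. fold (Cdist (eigval c s p) lam) in Ht.
    assert (Hn := vnorm_vsub_le l2_space (eigvec s p) v).
    assert (Hd : Cdist (eigval c s p) lam * vnorm (eigvec s p : l2_space) <= eps / 2).
    { apply Rle_trans with (eps / (2 * (vnorm v + 2)) * (vnorm v + 2)).
      - apply Rmult_le_compat; [apply Cmod_ge0|apply vnorm_nonneg|lra|lra].
      - right. field. lra. }
    change (vnorm (vsub (vscal (eigval c s p) (eigvec s p : l2_space)) (vscal lam v)) < eps).
    cbv beta in HN'. lra.
Qed.

(** * The limit eigenvalues are unimodular, distinct and uncountably many *)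

Lemma Cmod_eigval (c : nat -> C) (s : nat -> bool) (m : nat) :
  (forall j, Cmod (c j) = 1) -> Cmod (eigval c s m) = 1.
Proof.
  intros Hc. induction m as [|m IH]; simpl; [apply Cmod_C1|].
  destruct (s m); [|exact IH]. rewrite Cmod_mul, Hc, IH. ring.
Qed.

Lemma Cdist_Cmul_C1 (a b : C) : Cmod b = 1 -> Cdist (Cmul a b) b = Cdist a C1.
Proof.
  intros Hb. rewrite <- (Rmult_1_l (Cdist a C1)), <- Hb, <- Cdist_mul_l.
  f_equal; apply injective_projections; simpl; ring.
Qed.

Lemma eigval_tail (c : nat -> C) (s : nat -> bool) (p m : nat) :
  (forall j, Cmod (c j) = 1) ->
  (forall j, Cdist (c (S j)) C1 <= Cdist (c j) C1 / 5) -> (p <= m)%nat ->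
  Cdist (eigval c s m) (eigval c s p) <= 5 / 4 * Cdist (c p) C1.
Proof.
  intros H1 H5 Hpm.
  (* The ratio 1/5 sums to 5/4. With d_m = |c_m - 1|, a step costs at most d_m <= 5/4 (d_m -
     d_(m+1)), so the bound telescopes. *)
  assert (H : Cdist (eigval c s m) (eigval c s p) <= 5 / 4 * (Cdist (c p) C1 - Cdist (c m) C1)).
  { induction Hpm as [|m Hpm IH]; [rewrite Cdist_same; lra|].
    assert (Ht := Cdist_triangle (eigval c s (S m)) (eigval c s m) (eigval c s p)).
    assert (Hs : Cdist (eigval c s (S m)) (eigval c s m) <= Cdist (c m) C1).
    { simpl. destruct (s m).
      - right. apply Cdist_Cmul_C1. now apply Cmod_eigval.
      - rewrite Cdist_same. apply Cmod_ge0. }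
    specialize (H5 m). lra. }
  assert (H0 : 0 <= Cdist (c m) C1) by apply Cmod_ge0. lra.
Qed.

Lemma eigval_prefix (c : nat -> C) (s t : nat -> bool) (m : nat) :
  (forall j, (j < m)%nat -> s j = t j) -> eigval c s m = eigval c t m.
Proof.
  intros H. induction m as [|m IH]; simpl; [reflexivity|].
  rewrite (H m), IH by (intros; try apply H; lia). reflexivity.
Qed.

(** At the first difference p the finite products are |c_p - 1| apart, more than the later factors
    can compensate. *)
Lemma eigval_limit_inj (c : nat -> C) (s t : nat -> bool) (lam : C) :
  (forall j, Cmod (c j) = 1) -> (forall j, c j <> C1) ->
  (forall j, Cdist (c (S j)) C1 <= Cdist (c j) C1 / 5) ->
  Clim (eigval c s) lam -> Clim (eigval c t) lam -> forall j, s j = t j.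
Proof.
  intros H1 Hne H5 Hs Ht.
  apply (well_founded_ind lt_wf). intros p IH.
  assert (Hp : Cdist (eigval c s (S p)) (eigval c t (S p)) < Cdist (c p) C1).
  { assert (Hd := Cdist_gt0 _ _ (Hne p)). set (d := Cdist (c p) C1) in *.
    (* Each tail is at most 5/4 * d/5 = d/4; with two limit errors below d/8 the total stays below
       3d/4. *)
    destruct (Hs (d / 8)) as [N HN]; [lra|]. destruct (Ht (d / 8)) as [N' HN']; [lra|].
    set (m := max (S p) (max N N')).
    specialize (HN m ltac:(lia)). specialize (HN' m ltac:(lia)).
    assert (T1 := eigval_tail c s (S p) m H1 H5 ltac:(lia)).
    assert (T2 := eigval_tail c t (S p) m H1 H5 ltac:(lia)).
    specialize (H5 p). fold d in H5.
    assert (A1 := Cdist_triangle (eigval c s (S p)) (eigval c s m) (eigval c t (S p))).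
    assert (A2 := Cdist_triangle (eigval c s m) lam (eigval c t (S p))).
    assert (A3 := Cdist_triangle lam (eigval c t m) (eigval c t (S p))).
    rewrite (Cdist_sym (eigval c s (S p)) (eigval c s m)) in A1.
    rewrite (Cdist_sym lam (eigval c t m)) in A3. lra. }
  simpl in Hp. rewrite (eigval_prefix c s t p IH) in Hp.
  destruct (s p), (t p); trivial; exfalso.
  - rewrite Cdist_Cmul_C1 in Hp by now apply Cmod_eigval. lra.
  - rewrite Cdist_sym, Cdist_Cmul_C1 in Hp by now apply Cmod_eigval. lra.
Qed.

(** Cantor's diagonal argument: [s] differs at k from any binary label of [f k]. *)
Lemma binary_family_uncountable (Q : (nat -> bool) -> C -> Prop) (f : nat -> C) :
  (forall s, exists lam, Q s lam) ->
  (forall s t lam, Q s lam -> Q t lam -> forall j, s j = t j) ->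
  exists s lam, Q s lam /\ forall k, f k <> lam.
Proof.
  intros Hex Hinj.
  set (s := fun k => if excluded_middle_informative (exists t, Q t (f k) /\ t k = false)
                     then true else false).
  destruct (Hex s) as [lam Hlam]. exists s, lam. split; [exact Hlam|]. intros k Hk.
  destruct (s k) eqn:E; unfold s in E;
    destruct excluded_middle_informative as [H|H]; try discriminate.
  - destruct H as (t & Ht & Htk). rewrite Hk in Ht.
    assert (Hst := Hinj s t lam Hlam Ht k). unfold s in Hst at 1.
    destruct excluded_middle_informative as [_|H]; [congruence|].
    apply H. exists t. now rewrite Hk.
  (* Here [s] itself is a label of [f k] whose digit k is false, which the definition of [s] rules
     out. *)
  - apply H. exists s. rewrite Hk. split; [exact Hlam|]. unfold s.
    now destruct excluded_middle_informative.
Qed.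

(** * Choice of the unimodular numbers and the equivalence *)

Lemma small_sequence (n : nat -> nat) :
  ~ uniform_gap n ->
  exists c : nat -> C,
    (forall j, Cmod (c j) = 1) /\ (forall j, c j <> C1) /\
    (forall j, Cdist (c (S j)) C1 <= Cdist (c j) C1 / 5) /\
    (forall j, Cdist (c j) C1 <= (/ 4) ^ j) /\
    (forall j k, Cdist (Cpow (c j) (n k)) C1 <= (/ 4) ^ j).
Proof.
  intros Hn.
  (* Positivity of [eps] sits under the existential so that choice yields a total function on the
     reals. *)
  assert (Hg : forall eps, exists z, 0 < eps ->
    Cmod z = 1 /\ z <> C1 /\ Cdist z C1 <= eps /\ forall k, Cdist (Cpow z (n k)) C1 <= eps).
  { intros eps. apply NNPP. intros H. apply Hn. exists eps.
    split.
    - apply NNPP. intros H0. apply H. exists C0. intros H'. contradiction.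
    - intros z Hz Hz1. apply NNPP. intros H'. apply H. exists z. intros _.
      split; [exact Hz|]. split; [exact Hz1|]. split.
      + apply Rnot_lt_le. intros Hlt. apply H'. left. lra.
      + intros k. apply Rnot_lt_le. intros Hlt. apply H'. right. exists k. lra. }
  destruct (choice _ Hg) as [g Hgs].
  set (c := fix c j := match j with
                       | O => g 1
                       | S j => g (Rmin ((/ 4) ^ S j) (Cdist (c j) C1 / 5))
                       end).
  (* Each term is exhibited as [g] of a positive tolerance. The next tolerance is positive because
     c_j differs from 1. *)
  assert (Hc : forall j, exists eps, 0 < eps /\ eps <= (/ 4) ^ j /\ c j = g eps /\
                 forall i, j = S i -> eps <= Cdist (c i) C1 / 5).
  { induction j as [|j (eps & Heps & _ & Hce & _)].
    - exists 1. split; [lra|]. split; [simpl; lra|]. split; [reflexivity|]. discriminate.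
    - exists (Rmin ((/ 4) ^ S j) (Cdist (c j) C1 / 5)). split; [|split; [|split]].
      + apply Rmin_glb_lt; [apply pow_lt; lra|].
        assert (H : 0 < Cdist (c j) C1); [|lra].
        apply Cdist_gt0. rewrite Hce. now apply Hgs.
      + apply Rmin_l.
      + reflexivity.
      + intros i [= <-]. apply Rmin_r. }
  exists c. repeat split.
  - intros j. destruct (Hc j) as (eps & H1 & H2 & -> & H3). now apply Hgs.
  - intros j. destruct (Hc j) as (eps & H1 & H2 & -> & H3). now apply Hgs.
  - intros j. destruct (Hc (S j)) as (eps & H1 & H2 & -> & H3).
    apply Rle_trans with eps; [now apply Hgs|]. now apply H3.
  - intros j. destruct (Hc j) as (eps & H1 & H2 & -> & H3).
    apply Rle_trans with eps; [now apply Hgs|exact H2].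
  - intros j k. destruct (Hc j) as (eps & H1 & H2 & -> & H3).
    apply Rle_trans with eps; [now apply Hgs|exact H2].
Qed.

(** By contraposition: without a gap, the strong limit of the finite products violates countability
    on the sequence space. *)
Lemma Hilbertian_Jamison_uniform_gap (n : nat -> nat) :
  Hilbertian_Jamison_sequence n -> uniform_gap n.
Proof.
  intros Hn. apply NNPP. intros Hgap.
  destruct (small_sequence n Hgap) as (c & H1 & Hne & H5 & H4 & Hpow).
  destruct (strong_limit l2_space (twists c) (exp 4)) as (T & HTb & HT).
  { apply twists_add. }
  { apply twists_scal. }
  { intros m x. now apply twists_bound. }
  { apply l2_complete. }
  { intros x. now apply twists_cauchy. }
  destruct (Hn l2_Hilbert l2_infinite_dimensional T HTb) as [f Hf].
  (* The powers of T are strong limits of powers of the finite products. These are twists by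
     c_j^(n_k), within 4^-j of 1, so the bound exp 4 applies again. *)
  { exists (exp 4). intros k x.
    apply (converges_to_vnorm_le l2_space (fun m => Nat.iter (n k) (twists c m) x)).
    - apply (strong_limit_iter l2_space (twists c) (exp 4)); trivial.
      + apply twists_add.
      + apply twists_scal.
      + intros m y. now apply twists_bound.
    - intros m. rewrite iter_twists. apply twists_bound. intros j. apply Hpow. }
  destruct (binary_family_uncountable
              (fun s lam => Clim (eigval c s) lam /\ eigenvalue T lam) f) as (s & lam & [Hl He] & Hk).
  - intros s. now apply eigval_limit.
  - intros s t lam [Hs _] [Ht _]. now apply (eigval_limit_inj c s t lam).
  - destruct (Hf lam) as [k Hk']; [|exact He|now apply (Hk k)].
    apply (Clim_Cmod (eigval c s)); [exact Hl|]. intros m. now apply Cmod_eigval.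
Qed.

Theorem theorem1p2 (n : nat -> nat)
  (hpos : forall k, (0 < n k)%nat)
  (hincr : forall k, (n k < n (S k))%nat) :
  Hilbertian_Jamison_sequence n <-> Jamison_sequence n.
Proof.
  split.
  (* The gap condition is the bridge: Hilbert spaces force it, and it suffices on every separable
     Banach space. *)
  - intros Hn. now apply uniform_gap_Jamison, Hilbertian_Jamison_uniform_gap.
  - intros Hn H _ T HT Hp. exact (Hn H T HT Hp).
Qed.
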